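(* Let $n\ge 5$, $x\in[n]$, let $\mathscr{F}$ be a maximal weakly separated family of triangles in $[n]$, and let $v:\mathbb{C}[\mathscr{G}(3,n)]\to\mathbb{C}$ be an evaluation homomorphism at a point of $\mathscr{G}(3,n)$ with $v(t)=1$ for all $t\in\mathscr{F}_x$. Then the following algorithm, whose input is the graph $G(\mathscr{F}_x)$ and the values of $v$ on all border triangles of $\mathscr{F}_x$, computes $v(\{x-1,x+1,x+2\})$ and $v(\{x-2,x-1,x+1\})$ as the final values of $\mathrm{label}(x+1)$ and $\mathrm{label}(x-1)$ respectively. Let $P_1<_x\dots<_x P_s$ be the triangulation points of $\mathscr{F}_x$, let $Q_{i,1},\dots,Q_{i,r_i-1}$ be the leaves in $P_i$ ordered by $<_x$, and put $Q_{i,0}:=P_{i-1}$, $Q_{i,r_i}:=P_{i+1}$ (with $P_0=P_s$, $P_{s+1}=P_1$). 1. For each triangulation point $P_i\notin\{x+1,x-1\}$: remove all leaves in $P_i$ and set $\mathrm{label}(P_i):=\sum_{j=0}^{r_i-1}v(\{P_i,Q_{i,j},Q_{i,j+1}\})$. 2. If $x+2$ is a leaf: remove all leaves in $x+1$ except $x+2$ and set $\mathrm{label}(x+1):=\sum_{j=1}^{r_1-1}v(\{x+1,Q_{1,j},Q_{1,j+1}\})$. 3. If $x-2$ is a leaf: remove all leaves in $x-1$ except $x-2$ and set $\mathrm{label}(x-1):=\sum_{j=0}^{r_s-2}v(\{x-1,Q_{s,j},Q_{s,j+1}\})$. 4. While the current graph has more than $3$ edges: find a triangulation point (vertex of degree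 at least $2$ of the current graph) $P_i\notin\{x+1,x-1\}$ of degree $2$. (a) If $P_i=x+2$: set $\mathrm{label}(x+1):=\mathrm{label}(x+2)$; remove the edge from $x+2$ to its neighbour $P_j$ other than $x+1$; set $\mathrm{label}(P_j):=\mathrm{label}(P_j)+\mathrm{label}(x+2)$; remove the label at $x+2$. (b) Else if $P_i=x-2$: set $\mathrm{label}(x-1):=\mathrm{label}(x-2)$; remove the edge from $x-2$ to its neighbour $P_j$ other than $x-1$; set $\mathrm{label}(P_j):=\mathrm{label}(P_j)+\mathrm{label}(x-2)$; remove the label at $x-2$. (c) Else: let $P_j,P_k$ be the two neighbours of $P_i$; set $\mathrm{label}(P_j):=\mathrm{label}(P_j)+\mathrm{label}(P_i)$ and $\mathrm{label}(P_k):=\mathrm{label}(P_k)+\mathrm{label}(P_i)$; remove $P_i$ and its edges. 5. Output $v(\{x-1,x+1,x+2\})=\mathrm{label}(x+1)$ and $v(\{x-2,x-1,x+1\})=\mathrm{label}(x-1)$.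
   Context: Let $[n]=\{1,\dots,n\}$, with elements such as $x\pm1,x\pm2$ taken modulo $n$. A tuple $(a_1,\dots,a_r)$, $r\ge 3$, of pairwise distinct elements of $[n]$ is cyclically ordered if $a_1<\dots<a_r$ or there is $2\le i\le r$ with $a_i<a_{i+1}<\dots<a_r<a_1<\dots<a_{i-1}$. For distinct $a,b\in[n]\setminus\{x\}$ write $a<_x b$ if $(x,a,b)$ is cyclically ordered; this is a total order on $[n]\setminus\{x\}$. A triangle is a subset of $[n]$ with exactly $3$ elements. Two triangles $A,B$ are crossing if there are $a,c\in A\setminus B$ and $b,d\in B\setminus A$ such that $(a,b,c,d)$ is cyclically ordered; otherwise they are weakly separated. A weakly separated family of triangles is a set of pairwise non-crossing triangles in $[n]$; it is maximal if it is not properly contained in another weakly separated family of triangles in $[n]$. Put $\mathscr{F}_x=\{C\in\mathscr{F}\mid x\in C\}$. The graph $G(\mathscr{F}_x)$ has as vertices the elements of $[n]\setminus\{x\}$ that occur in some triangle of $\mathscr{F}_x$, and has an edge between $a$ and $b$ for every triangle $\{x,a,b\}\in\mathscr{F}_x$. The vertices of $G(\mathscr{F}_x)$ of degree at least $2$ are the triangulation points of $\mathscr{F}_x$. All other vertices have degree $1$, and each is joined by its edge to a triangulation point; a degree-$1$ vertex joined to the triangulation point $P$ is called a leaf in $P$. The points $x+1$ and $x-1$ are the first and last triangulation points with respect to $<_x$, i.e. $P_1=x+1$ and $P_s=x-1$. The border triangles of $\mathscr{F}_x$ are the triangles $\{P_i,Q_{i,j},Q_{i,j+1}\}$, $1\le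 i\le s$, $0\le j\le r_i-1$, except those with $(i,j)=(1,0)$ or $(i,j)=(s,r_s-1)$; they all belong to $\mathscr{F}$. $\mathbb{C}[\mathscr{G}(3,n)]$ is the homogeneous coordinate ring of the Grassmannian of $3$-dimensional subspaces of $\mathbb{C}^n$ in the Plücker embedding, generated by the Plücker coordinates $\Delta^{a,b,c}$ (antisymmetric in the indices). An evaluation homomorphism at a point is the algebra homomorphism $\mathbb{C}[\mathscr{G}(3,n)]\to\mathbb{C}$ given by evaluating at a chosen representative of the homogeneous coordinates of that point. For a triangle $\{a,b,c\}$, $v(\{a,b,c\}):=v(\Delta^{a',b',c'})$ with $a'<b'<c'$ the elements $a,b,c$ in increasing order. *)

(* Defs.v *)
From HB Require Import structures.
From mathcomp Require Import all_boot all_order all_algebra.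
From mathcomp Require Import boolp reals.
From mathcomp Require Import complex.
From mathcomp Require Import mpoly.

Set Implicit Arguments.
Unset Strict Implicit.
Unset Printing Implicit Defensive.

Import GRing.Theory.
Local Open Scope ring_scope.
Local Open Scope quotient_scope.

(* The elements of [n] are represented by 'I_n, with values 0, ..., n - 1;
   x + 1 and x - 1 modulo n are [ordS x] and [ord_pred x]. *)

Section Triangles.
Variable n : nat.
Implicit Types (x a b : 'I_n) (A B : {set 'I_n}) (F : {set {set 'I_n}}).

Definition cyc_ordered (s : seq 'I_n) : bool :=
  (3 <= size s)%N &&
  [exists k : 'I_(size s), sorted (fun a b => (a < b)%N) (rot k s)].

Definition cyc_lt x a b : bool := cyc_ordered [:: x; a; b].
Definition cyc_le x a b : bool := (a == b) || cyc_lt x a b.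

Definition triangle A : bool := #|A| == 3.

Definition crossing A B : bool :=
  [exists a in A :\: B, exists c in A :\: B,
   exists b in B :\: A, exists d in B :\: A, cyc_ordered [:: a; b; c; d]].

Definition weakly_separated F : bool :=
  [forall A in F, triangle A] && [forall A in F, forall B in F, ~~ crossing A B].

Definition max_weakly_separated F : bool := maxset weakly_separated F.

Definition star F x : {set {set 'I_n}} := [set C in F | x \in C].

End Triangles.

(* Graphs on subsets of 'I_n without isolated vertices, given by their set of
   two-element edges; the vertices are the elements occurring in an edge. *)

Section Graphs.
Variable n : nat.
Implicit Types (x a b P Q : 'I_n) (G : {set {set 'I_n}}).

(* The triangle {x, a, b} of F gives the edge {a, b}. *)
Definition star_graph (F : {set {set 'I_n}}) x : {set {set 'I_n}} :=
  [set C :\ x | C in star F x].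

Definition nbrs G a : {set 'I_n} := [set b | (b != a) && ([set a; b] \in G)].
Definition deg G a : nat := #|nbrs G a|.

Definition tri_point G P : bool := (2 <= deg G P)%N.
Definition leaf_in G P Q : bool :=
  [&& deg G Q == 1, tri_point G P & Q \in nbrs G P].
Definition is_leaf G Q : bool := [exists P, leaf_in G P Q].

(* P_1, ..., P_s *)
Definition tri_points G x : seq 'I_n := sort (cyc_le x) (enum (tri_point G)).

(* Q_{i,1}, ..., Q_{i,r_i-1} for P = P_i *)
Definition leaves G x P : seq 'I_n := sort (cyc_le x) (enum (leaf_in G P)).

(* Q_{i,0}, ..., Q_{i,r_i} for P = P_i; [prev] and [next] are cyclic, which
   accounts for P_0 = P_s and P_{s+1} = P_1. *)
Definition fan G x P : seq 'I_n :=
  prev (tri_points G x) P :: rcons (leaves G x P) (next (tri_points G x) P).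

(* r_i for P = P_i *)
Definition fan_len G x P : nat := (size (leaves G x P)).+1.

(* {P_i, Q_{i,j}, Q_{i,j+1}} for P = P_i *)
Definition fan_triangle G x P (j : nat) : {set 'I_n} :=
  [set P; nth P (fan G x P) j; nth P (fan G x P) j.+1].

(* The two excluded pairs are (i, j) = (1, 0) and (i, j) = (s, r_s - 1), with
   P_1 = x + 1 and P_s = x - 1. *)
Definition border_triangle G x (A : {set 'I_n}) : Prop :=
  exists P j,
    [/\ tri_point G P, (j < fan_len G x P)%N,
        ~ (P = ordS x /\ j = 0%N),
        ~ (P = ord_pred x /\ j = (fan_len G x P).-1)
      & A = fan_triangle G x P j].

End Graphs.

(* The homogeneous coordinate ring of the Grassmannian of 3-dimensional
   subspaces of C^n, with C = R[i], in its Pluecker embedding. *)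

Section CoordinateRing.
Variables (R : realType) (n : nat).

Definition triple : finType := ('I_n * 'I_n * 'I_n)%type.

(* One indeterminate for each triple of indices. *)
Definition poly_ring := {mpoly R[i][#|triple|]}.

Definition minor (M : 'M[R[i]]_(3, n)) (t : triple) : R[i] :=
  \det (colsub (tnth [tuple t.1.1; t.1.2; t.2]) M).

(* For M of rank 3, the vector of its maximal minors represents the homogeneous
   coordinates of its row space; a base change g multiplies it by \det g, so all
   representatives are obtained from the bases of that space.  The M of smaller
   rank give the vertex 0 of the affine cone. *)
Definition plucker_vec (M : 'M[R[i]]_(3, n)) (k : 'I_#|triple|) : R[i] :=
  minor M (enum_val k).

(* The ideal of the affine cone over the Grassmannian; the antisymmetry in the
   indices belongs to its relations. *)
Definition plucker_ideal : {pred poly_ring} :=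
  [pred p | `[< forall M : 'M[R[i]]_(3, n), p.@[plucker_vec M] = 0 >]].

Lemma plucker_ideal_closed : idealr_closed plucker_ideal.
Proof.
split.
- by apply/asboolP => M; rewrite meval0.
- by apply/asboolP => /(_ 0) /eqP; rewrite meval1 oner_eq0.
- move=> a u w /asboolP Hu /asboolP Hw; apply/asboolP => M.
  by rewrite mevalD mevalM Hu Hw mulr0 addr0.
Qed.

HB.instance Definition _ :=
  isIdealr.Build poly_ring plucker_ideal plucker_ideal_closed.

Definition coord_ring := {ideal_quot plucker_ideal}.
HB.instance Definition _ := GRing.ComNzRing.on coord_ring.

Definition coord_class (p : poly_ring) : coord_ring := \pi_coord_ring p.

Definition Delta (a b c : 'I_n) : coord_ring :=
  coord_class 'X_(enum_rank ((a, b, c) : triple)).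

Definition evaluation_hom (v : {rmorphism coord_ring -> R[i]}) : Prop :=
  exists2 M : 'M[R[i]]_(3, n), row_free M &
    forall p : poly_ring, v (coord_class p) = p.@[plucker_vec M].

(* [enum A] lists the elements of A in increasing order. *)
Definition tri_val (v : {rmorphism coord_ring -> R[i]}) (A : {set 'I_n}) : R[i] :=
  if enum A is [:: a; b; c] then v (Delta a b c) else 0.

End CoordinateRing.

(* The algorithm.  It only has access to the point x, to the graph G, and to a
   function w giving the values of triangles. *)

Section Algorithm.
Variables (C : nmodType) (n : nat) (x : 'I_n).

Local Notation "x+1" := (ordS x).
Local Notation "x-1" := (ord_pred x).
Local Notation "x+2" := (ordS (ordS x)).
Local Notation "x-2" := (ord_pred (ord_pred x)).

(* Current graph and current labels, [None] meaning that there is no label. *)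
Definition state : Type := ({set {set 'I_n}} * {ffun 'I_n -> option C})%type.

(* Adding to or with a missing label leaves no label.  A label obtained in the
   end has thus been computed without reading a missing one. *)
Definition add_label (l m : option C) : option C :=
  if (l, m) is (Some c, Some d) then Some (c + d) else None.

Section Initialization.
Variables (G : {set {set 'I_n}}) (w : {set 'I_n} -> C).

Definition removed_leaf (Q : 'I_n) : bool :=
  [exists P, leaf_in G P Q &&
    [|| (P != x+1) && (P != x-1),
        [&& P == x+1, is_leaf G x+2 & Q != x+2]
      | [&& P == x-1, is_leaf G x-2 & Q != x-2]]].

Definition init_graph : {set {set 'I_n}} :=
  [set e in G | [forall Q in e, ~~ removed_leaf Q]].

Definition fan_sum (P : 'I_n) (lo hi : nat) : C :=
  \sum_(lo <= j < hi) w (fan_triangle G x P j).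

Definition init_label : {ffun 'I_n -> option C} :=
  [ffun P =>
    if P == x+1 then
      if is_leaf G x+2 then Some (fan_sum P 1 (fan_len G x P)) else None
    else if P == x-1 then
      if is_leaf G x-2 then Some (fan_sum P 0 (fan_len G x P).-1) else None
    else if tri_point G P then Some (fan_sum P 0 (fan_len G x P))
    else None].

(* The state after steps 1 to 3. *)
Definition init_state : state := (init_graph, init_label).

End Initialization.

Definition selectable (E : {set {set 'I_n}}) (P : 'I_n) : bool :=
  [&& P != x+1, P != x-1 & deg E P == 2].

(* One execution of the body of the loop of step 4, for any choice of P_i. *)
Variant loop_body : state -> state -> Prop :=
| LoopA E l j of selectable E x+2 & j \in nbrs E x+2 & j != x+1 :
    loop_body (E, l)
      (E :\ [set x+2; j],
       [ffun q => if q == x+1 then l x+2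
                  else if q == j then add_label (l j) (l x+2)
                  else if q == x+2 then None
                  else l q])
| LoopB E l j of selectable E x-2 & x-2 != x+2 & j \in nbrs E x-2 & j != x-1 :
    loop_body (E, l)
      (E :\ [set x-2; j],
       [ffun q => if q == x-1 then l x-2
                  else if q == j then add_label (l j) (l x-2)
                  else if q == x-2 then None
                  else l q])
| LoopC E l i j k of selectable E i & i != x+2 & i != x-2
    & nbrs E i = [set j; k] & j != k :
    loop_body (E, l)
      ([set e in E | i \notin e],
       [ffun q => if q == j then add_label (l j) (l i)
                  else if q == k then add_label (l k) (l i)
                  else if q == i then None
                  else l q]).

Definition running (st : state) : bool := (3 < #|st.1|)%N.

(* Started in the given state, the loop always finds a P_i to proceed with, it
   terminates, and its final state satisfies [post], whatever choices of P_i are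
   made.  Termination is enforced by the inductive nature of the definition. *)
Inductive loop_ensures (post : state -> Prop) : state -> Prop :=
| LoopExit st of ~~ running st & post st : loop_ensures post st
| LoopIter st of running st
    & (exists st', loop_body st st')
    & (forall st', loop_body st st' -> loop_ensures post st') :
    loop_ensures post st.

Definition algorithm_computes (G : {set {set 'I_n}}) (w : {set 'I_n} -> C)
    (out1 out2 : C) : Prop :=
  loop_ensures (fun st => st.2 x+1 = Some out1 /\ st.2 x-1 = Some out2)
    (init_state G w).

End Algorithm.

(* Main.v *)
Require Import Defs.
From mathcomp Require Import all_boot all_order all_algebra.
From mathcomp Require Import reals complex mpoly.
From mathcomp Require Import zify ring.

Set Implicit Arguments.
Unset Strict Implicit.
Unset Printing Implicit Defensive.

(** Deleting [x] from the triangles of [F] that contain it leaves pairwise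
    non-crossing chords between the other points.  The claim to understand is that
    they are the sides and diagonals of a triangulated polygon, whose corners are
    the triangulation points, together with leaves hanging between consecutive
    corners; then the algorithm just eats up the polygon corner by corner.

    The shape of the graph comes from the maximality of [F].  A triangle [T] of [F]
    avoiding [x] crosses [{x, a, b}] exactly if one of [a] and [b] is outside [T]
    and lies, in the order seen from [x], between two points of [T] different from
    the other one ([crossing_far]).  Such a [T] must contain every neighbour of the point that it
    surrounds, and two neighbours are one too many ([tri_one_sided]).  So a chord
    between two triangulation points can only be missing because it crosses a chord
    of the graph ([tri_planar_max]), which makes consecutive corners adjacent and
    all bounded faces triangles.  A finer analysis of the blocking triangles shows
    that a point of degree one is joined to one of the two corners next to it
    ([gap_nbr]).

    The values enter through one identity.  Since [v] is 1 on all the triangles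
    [{x, p, a}] of [F], the three-term Pluecker relation turns into
    [v {p, a, b} + v {p, b, c} = v {p, a, c}] for neighbours [a], [b], [c] of [p]
    in the order seen from [x] ([tri_val_fan_additive]).  The sums of the
    initialization therefore telescope to the value of the triangle formed by a
    corner, its predecessor and its successor ([init_invariant]).  This description
    of the labels survives the loop: a corner [i] of degree two lies between corners
    [a] and [b] joined by a diagonal, its label is the value of [{a, i, b}], and
    adding it to the labels of [a] and [b] replaces [i] by [b], respectively [a], in
    their triangles ([loop_invariant_removed]).  At [x + 1] and [x - 1] the neighbours
    [x - 1] and [x + 1] are replaced by [x + 2] and [x - 2], so that the two labels
    left at the end, when the polygon has shrunk to the chord from [x + 1] to
    [x - 1], are the required values ([loop_correct]). *)

(** Linear arithmetic on positions, without the membership facts of the context. *)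
Ltac pos_lia :=
  repeat match goal with
  | H : context [_ \in _] |- _ => clear H
  | H := _ |- _ => clear H
  end; lia.

(** * The link of a point in a maximal weakly separated family *)

Section Link.

Variables (n : nat) (x : 'I_n) (G H : {set {set 'I_n}}).
Implicit Types (pos : 'I_n -> nat) (a b c d l p q u y z : 'I_n).
Implicit Types (S T : {set 'I_n}).

Lemma nbrs_sym a b : (a \in nbrs G b) = (b \in nbrs G a).
Proof. by rewrite !inE eq_sym setUC. Qed.

(** For [T] avoiding [x], this is the crossing of [T] with [{x, a, b}] in which [x]
    and [a] separate [y] from [z]. *)
Definition blocks pos T a b : Prop :=
  exists y z, [/\ y \in T :\ b, z \in T :\ b, a \notin T, pos y < pos a
                & pos a < pos z].

(** The chord [c, d] starts strictly inside the interval [a, b] and leaves it. *)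
Definition separated pos a b c d : Prop :=
  [/\ pos a < pos c, pos c < pos b & (pos d < pos a) || (pos b < pos d)].

(** What the structure of the graph depends on: [G] is the graph of the triangles
    of [F] through [x], [H] consists of the other triangles of [F], and [pos] numbers
    the points in the cyclic order starting at [x].  In this form the properties are
    stable under reversing the order, so that each argument is needed on one side
    only. *)
Record link_axioms (N : nat) pos : Prop := LinkAxioms {
  pos_inj : injective pos;
  pos_le : forall a, pos a <= N;
  link_nbr_neq : forall a b, b \in nbrs G a -> b != x;
  link_card : forall T, T \in H -> #|T| = 3;
  link_unblocked : forall T a b, b \in nbrs G a -> T \in H -> ~ blocks pos T a b;
  link_planar : forall a b c d, b \in nbrs G a -> d \in nbrs G c ->
    ~ separated pos a b c d;
  link_noncrossing : forall T T' u l y z, T \in H -> T' \in H ->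
    u \in T :\: T' -> z \in T :\: T' -> y \in T' :\: T -> l \in T' :\: T ->
    pos y < pos u -> pos u < pos l -> pos l < pos z -> False;
  link_max : forall a b, a != x -> b != x -> pos a < pos b ->
    (forall T, T \in H -> ~ blocks pos T a b /\ ~ blocks pos T b a) ->
    (forall c d, d \in nbrs G c -> ~ separated pos a b c d) ->
    b \in nbrs G a
}.

Lemma link_axioms_flip N pos :
  link_axioms N pos -> link_axioms N (fun a => N - pos a).
Proof.
move=> A; have le := pos_le A.
have fl a b : (N - pos a < N - pos b) = (pos b < pos a).
  by move: (le a) (le b); pos_lia.
have bl T a b : blocks (fun a => N - pos a) T a b -> blocks pos T a b.
  by case=> y [z []]; rewrite !fl => ? ? ? ? ?; exists z, y.
have bl' T a b : blocks pos T a b -> blocks (fun a => N - pos a) T a b.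
  by case=> y [z [? ? ? ? ?]]; exists z, y; split; rewrite ?fl.
have sp a b c d : separated (fun a => N - pos a) a b c d -> separated pos b a c d.
  by case; rewrite !fl orbC.
have sp' a b c d : separated pos b a c d -> separated (fun a => N - pos a) a b c d.
  by case=> ? ? ?; split; rewrite !fl // orbC.
split.
- by move=> a b e; apply: (pos_inj A); move: (le a) (le b) e; pos_lia.
- by move=> a; apply: leq_subr.
- exact: link_nbr_neq A.
- exact: link_card A.
- by move=> T a b ab TH /bl; apply: link_unblocked A _ _ _ ab TH.
- by move=> a b c d ab cd /sp; apply: (link_planar A) cd; rewrite nbrs_sym.
- move=> T T' u l y z TH TH' uT zT yT' lT'; rewrite !fl => *.
  by apply: (link_noncrossing A TH' TH lT' yT' zT uT).
move=> a b ax bx; rewrite fl => ba noT noE.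
rewrite nbrs_sym; apply: (link_max A bx ax ba).
  by move=> T /noT[h1 h2]; split=> /bl'.
by move=> c d cd /sp'; apply: noE.
Qed.

Lemma tri_pointP a : reflect (exists b c, [/\ b \in nbrs G a, c \in nbrs G a & b != c])
  (tri_point G a).
Proof. exact: card_gt1P. Qed.

Definition tri_set : {set 'I_n} := [set a | tri_point G a].

Definition consecutive pos S a b : Prop :=
  [/\ a \in S, b \in S, pos a < pos b
    & forall c, c \in S -> ~ (pos a < pos c /\ pos c < pos b)].

Section Gaps.
Variables (N : nat) (pos : 'I_n -> nat).
Hypothesis A : link_axioms N pos.

Lemma tri_neq a : tri_point G a -> a != x.
Proof.
case/tri_pointP=> b [c [ab _ _]].
by apply: (link_nbr_neq A (a := b)); rewrite nbrs_sym.
Qed.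

(** Otherwise [x] and [q] would separate [y] from [z], two points of [T] outside the
    triangle [{x, q, u}]. *)
Lemma two_sided_nbr q u T y z : u \in nbrs G q -> T \in H -> q \notin T ->
  y \in T -> z \in T -> pos y < pos q -> pos q < pos z -> u = y \/ u = z.
Proof.
move=> qu TH qT yT zT yq qz.
case: (eqVneq u y) => [|uy]; first by left.
case: (eqVneq u z) => [|uz]; first by right.
case: (link_unblocked A qu TH); exists y, z.
by rewrite !inE ![_ == u]eq_sym uy uz.
Qed.

(** By [two_sided_nbr], two different neighbours of [q] would both be in [T] and on
    opposite sides of [q].  The third point of [T] then forms another separated pair
    with one of them, and this pair misses the second neighbour. *)
Lemma tri_one_sided q T y z : tri_point G q -> T \in H -> q \notin T ->
  y \in T -> z \in T -> pos y < pos q -> pos q < pos z -> False.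
Proof.
case/tri_pointP=> u [u' [qu qu' uu']] TH qT yT zT yq qz.
have key y1 z1 : y1 \in T -> z1 \in T -> pos y1 < pos q -> pos q < pos z1 ->
    (u = y1 /\ u' = z1) \/ (u = z1 /\ u' = y1).
  move=> y1T z1T y1q qz1.
  have := two_sided_nbr qu TH qT y1T z1T y1q qz1.
  have := two_sided_nbr qu' TH qT y1T z1T y1q qz1.
  by case=> e1 [] e2; rewrite e1 e2 ?eqxx in uu' *; auto.
have [t tT /andP[ty tz]] : exists2 t, t \in T & (t != y) && (t != z).
  have : 0 < #|T :\ y :\ z|.
    have zy : z != y by apply/eqP => e; subst z; pos_lia.
    by have := link_card A TH; rewrite (cardsD1 y T) yT (cardsD1 z (T :\ y)) !inE zT zy /= !add1n => -[->].
  by case/card_gt0P=> t; rewrite !inE => /and3P[tz ty tT]; exists t; rewrite ?ty.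
have tq : pos t != pos q.
  by apply/eqP => /(pos_inj A) e; rewrite -e tT in qT.
have k1 := key y z yT zT yq qz.
have [tq'|qt] : pos t < pos q \/ pos q < pos t by pos_lia.
  have k2 := key t z tT zT tq' qz.
  by case: k1 => [][e1 e2]; case: k2 => [][e3 e4]; move: uu' ty tz;
    rewrite -?e1 -?e2 -?e3 -?e4 ?eqxx.
have k2 := key y t yT tT yq qt.
by case: k1 => [][e1 e2]; case: k2 => [][e3 e4]; move: uu' ty tz;
  rewrite -?e1 -?e2 -?e3 -?e4 ?eqxx.
Qed.

Lemma gap_not_tri a b c : consecutive pos tri_set a b ->
  pos a < pos c -> pos c < pos b -> tri_point G c -> False.
Proof. by case=> _ _ _ h ac cb tc; apply: (h c); rewrite ?inE. Qed.

Lemma one_nbr a u u' : ~ tri_point G a -> u \in nbrs G a -> u' \in nbrs G a ->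
  u = u'.
Proof.
move=> nt au au'; case: (eqVneq u u') => // uu'.
by case: nt; apply/tri_pointP; exists u, u'.
Qed.

(** If points of the gap had neighbours below [a], the one closest to [a] could also
    be joined to [a], and would then have degree two: a chord in the way would cross
    its edge or belong to a closer point, and a triangle in the way would cross its
    edge or be two-sided at [a]. *)
Lemma gap_no_lower_nbr a b l u : consecutive pos tri_set a b ->
  pos a < pos l -> pos l < pos b -> u \in nbrs G l -> pos a <= pos u.
Proof.
move=> ab al lb lu; rewrite leqNgt; apply/negP => ua.
pose Q l := [&& pos a < pos l, pos l < pos b &
                [exists u, (u \in nbrs G l) && (pos u < pos a)]].
have Ql : Q l by rewrite /Q al lb; apply/existsP; exists u; rewrite lu.
case: (arg_minnP pos Ql) => {lu ua Ql al lb} {l u}l.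
case/and3P=> al lb /existsP[u /andP[lu ua]] lmin.
have ta : tri_point G a by case: ab => h _ _ _; move: h; rewrite inE.
have ntl := gap_not_tri ab al lb.
suff gl : l \in nbrs G a.
  rewrite nbrs_sym in gl; have e := one_nbr ntl gl lu.
  by rewrite e in ua; pos_lia.
have lx : l != x by apply: (link_nbr_neq A (a := u)); rewrite nbrs_sym.
apply: (link_max A (tri_neq ta) lx al).
- move=> T TH; split=> [][y [z []]]; rewrite !inE.
    move=> /andP[_ yT] /andP[_ zT] aT ya az.
    exact: (tri_one_sided ta TH aT yT zT).
  move=> /andP[ya yT] /andP[za zT] lT yl lz.
  have [uy|uz] := two_sided_nbr lu TH lT yT zT yl lz; last by subst u; pos_lia.
  subst y; case: (boolP (a \in T)) => aT.
    have [e|e] := two_sided_nbr lu TH lT aT zT al lz; subst u; pos_lia.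
  by apply: (tri_one_sided ta TH aT yT zT) => //; pos_lia.
move=> c d cd [ac cl dout].
have [da|ld] := orP dout.
  have Qc : Q c.
    by rewrite /Q ac /=; apply/andP; split; [pos_lia|]; apply/existsP; exists d; rewrite cd.
  by have := lmin _ Qc; pos_lia.
have ul : l \in nbrs G u by rewrite nbrs_sym.
by apply: (link_planar A ul cd); split=> //; [pos_lia|rewrite ld orbT].
Qed.

(** The setting of the next two lemmas is an isolated edge [u, l] inside a gap, chosen
    outermost, and a candidate [c] below [u] for an additional neighbour of [l], which
    is [a] or the last leaf of [b] below [u].  They describe what can prevent
    [{x, c, l}] from being in [F].  A chord cannot: leaving the interval [c, l] it
    would cross [u, l] or [c, b], surround [u, l], or be a later leaf of [b]. *)
Lemma gap_chord_planar a b u l c : consecutive pos tri_set a b ->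
  (forall l u, pos a < pos l -> pos l < pos b -> u \in nbrs G l ->
     pos a <= pos u /\ pos u <= pos b) ->
  u \in nbrs G l -> pos a <= pos c -> pos c < pos u -> pos u < pos l ->
  pos l < pos b ->
  (forall l' u', u' \in nbrs G l' -> pos a < pos u' -> pos u' < pos u ->
    pos l < pos l' -> pos l' < pos b -> False) ->
  c = a \/ b \in nbrs G c ->
  (forall c', b \in nbrs G c' -> pos c < pos c' -> pos c' < pos u -> False) ->
  forall e f, f \in nbrs G e -> ~ separated pos c l e f.
Proof.
move=> ab ingap lu ac cu ul lb outer cb cmax e f ef [ce el fout].
have nte : ~ tri_point G e by apply: (gap_not_tri ab); pos_lia.
have ntl : ~ tri_point G l by apply: (gap_not_tri ab); pos_lia.
have ntu : ~ tri_point G u by apply: (gap_not_tri ab); pos_lia.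
have ul' : l \in nbrs G u by rewrite nbrs_sym.
case: (eqVneq e u) => [eu|/eqP eu].
  by subst e; have fl := one_nbr ntu ef ul'; subst f; pos_lia.
have peu : pos e <> pos u by move=> /(pos_inj A).
have [fa fb] : pos a <= pos f /\ pos f <= pos b by apply: (ingap e) => //; pos_lia.
have [ue|eu'] : pos u < pos e \/ pos e < pos u by pos_lia.
  by apply: (link_planar A ul' ef); split=> //; move: fout; pos_lia.
have [fc|lf] := orP fout.
  case: cb => [ca|cb]; first by subst c; pos_lia.
  by apply: (link_planar A cb ef); split=> //; [pos_lia|rewrite fc].
case: (eqVneq f b) => [e1|/eqP fneb].
  by subst f; apply: (cmax e) => //; pos_lia.
have pfb : pos f <> pos b by move=> /(pos_inj A).
by apply: (outer f e); rewrite 1?nbrs_sym //; pos_lia.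
Qed.

(** A triangle can, but only if it surrounds [l], as surrounding [c] would make it
    contain [b] and surround [l] without [u]. *)
Lemma gap_blocker a b u l c T : consecutive pos tri_set a b ->
  u \in nbrs G l -> pos a <= pos c -> pos c < pos u -> pos u < pos l ->
  pos l < pos b -> c = a \/ b \in nbrs G c ->
  T \in H -> blocks pos T c l \/ blocks pos T l c ->
  [/\ u \in T, l \notin T, exists2 z, z \in T & pos l < pos z
    & forall y, y \in T -> y = u \/ pos l < pos y].
Proof.
move=> ab lu ac cu ul lb cb TH.
have ta : tri_point G a by case: ab => h _ _ _; move: h; rewrite inE.
have base : blocks pos T l c -> [/\ u \in T, l \notin T, exists2 z, z \in T & pos l < pos z
    & forall y, y \in T -> y = u \/ pos l < pos y].
  case=> y [z []]; rewrite !inE => /andP[yc yT] /andP[zc zT] lT yl lz.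
  have [uy|uz] := two_sided_nbr lu TH lT yT zT yl lz; last by subst u; pos_lia.
  subst y; split=> //; first by exists z.
  move=> t tT; case: (ltnP (pos l) (pos t)) => [|tl]; [by right|left].
  have tl' : pos t != pos l by apply/eqP => /(pos_inj A) e; rewrite -e tT in lT.
  have [//|e] := two_sided_nbr lu TH lT tT zT ltac:(pos_lia) lz.
  by subst u; pos_lia.
case=> // -[y [z []]]; rewrite !inE => /andP[yl yT] /andP[zl zT] cT yc cz.
case: cb => [e|cb]; first by subst c; case: (tri_one_sided ta TH cT yT zT).
have [e|e] := two_sided_nbr cb TH cT yT zT yc cz; first by subst b; pos_lia.
subst z; case: (boolP (l \in T)) => lT.
  have [e|e] := two_sided_nbr cb TH cT yT lT yc ltac:(pos_lia); subst b; pos_lia.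
have [e|e] := two_sided_nbr lu TH lT yT zT ltac:(pos_lia) lb; subst u; pos_lia.
Qed.

End Gaps.

Lemma consecutive_flip N pos S a b : (forall c, pos c <= N) ->
  consecutive pos S a b -> consecutive (fun c => N - pos c) S b a.
Proof.
move=> le [aS bS ab gap]; split=> //; first by move: (le a) (le b); pos_lia.
by move=> c cS; move: (gap c cS) (le a) (le b) (le c); pos_lia.
Qed.

Section Structure.
Variables (N : nat) (pos : 'I_n -> nat).
Hypothesis A : link_axioms N pos.

Lemma gap_nbr_bounds a b l u : consecutive pos tri_set a b ->
  pos a < pos l -> pos l < pos b -> u \in nbrs G l ->
  pos a <= pos u /\ pos u <= pos b.
Proof.
move=> ab al lb lu; split; first exact: (gap_no_lower_nbr A ab al lb lu).
have le := pos_le A.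
have := gap_no_lower_nbr (link_axioms_flip A) (consecutive_flip le ab) _ _ lu.
by move: (le l) (le a) (le b) (le u); pos_lia.
Qed.

(** The edge [u, l] would admit a further edge, from [l] to a point [c] below [u] or
    from [u] to a point [d] above [l]: the triangles blocking the two chords, which
    [gap_blocker] describes, cross each other.  But [u] and [l] have degree one. *)
Lemma gap_no_edge a b u l : consecutive pos tri_set a b ->
  pos a < pos u -> pos u < pos l -> pos l < pos b -> u \in nbrs G l -> False.
Proof.
move=> ab au ul lb lu; have le := pos_le A; have inj := pos_inj A.
pose Q (p : 'I_n * 'I_n) := [&& pos a < pos p.1, pos p.1 < pos p.2,
  pos p.2 < pos b & p.1 \in nbrs G p.2].
have Qul : Q (u, l) by rewrite /Q au ul lb lu.
(* an outermost edge inside the gap *)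
case: (arg_maxnP (fun p : 'I_n * 'I_n => pos p.2 - pos p.1) Qul) => {Qul au ul lb lu} -[{}u {}l].
case/and4P=> /= au ul lb lu lmax.
have outer l' u' : u' \in nbrs G l' -> pos a < pos u' -> pos u' < pos u ->
    pos l < pos l' -> pos l' < pos b -> False.
  move=> e1 h1 h2 h3 h4.
  have Q' : Q (u', l') by rewrite /Q /= e1 h1 h4 andbT; pos_lia.
  by have := lmax _ Q'; rewrite /=; pos_lia.
(* [c] is [a] or the last leaf of [b] below [u]; symmetrically, [d] is [b] or the
   first leaf of [a] above [l] *)
pose Qc c := [&& pos a <= pos c, pos c < pos u & (c == a) || (b \in nbrs G c)].
have Qa : Qc a by rewrite /Qc leqnn au eqxx.
case: (arg_maxnP pos Qa) => c /and3P[ac cu cb] cmax.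
pose Qd d := [&& pos l < pos d, pos d <= pos b & (d == b) || (a \in nbrs G d)].
have Qb : Qd b by rewrite /Qd leqnn lb eqxx.
case: (arg_minnP pos Qb) => d /and3P[ld db da] dmin.
have cb' : c = a \/ b \in nbrs G c by case/orP: cb => [/eqP|]; [left|right].
have da' : d = b \/ a \in nbrs G d by case/orP: da => [/eqP|]; [left|right].
have ul' : l \in nbrs G u by rewrite nbrs_sym.
have A' := link_axioms_flip A; have ab' := consecutive_flip le ab.
have fl e f : (N - pos e < N - pos f) = (pos f < pos e).
  by move: (le e) (le f); pos_lia.
have fle e f : (N - pos e <= N - pos f) = (pos f <= pos e).
  by move: (le e) (le f); pos_lia.
have ntl : ~ tri_point G l by apply: (gap_not_tri ab); pos_lia.
have ntu : ~ tri_point G u by apply: (gap_not_tri ab); pos_lia.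
have [ta tb] : tri_point G a /\ tri_point G b.
  by case: ab => h1 h2 _ _; move: h1 h2; rewrite !inE.
have no_block T T' : T \in H -> T' \in H ->
    blocks pos T c l \/ blocks pos T l c ->
    blocks (fun e => N - pos e) T' d u \/ blocks (fun e => N - pos e) T' u d ->
    False.
  move=> TH TH' B B'.
  have [uT lT [z zT lz] Tu] := gap_blocker A ab lu ac cu ul lb cb' TH B.
  have := gap_blocker A' ab' ul' _ _ _ _ da' TH' B'; rewrite !fl !fle.
  case=> // lT' uT' [y yT']; rewrite fl => yu Tl.
  apply: (link_noncrossing A TH TH' (u := u) (l := l) (y := y) (z := z)) => //;
    rewrite !inE ?uT ?lT ?uT' ?lT' ?zT ?yT' ?andbT //; apply/negP.
    by move=> /Tl; rewrite fl => -[e|]; [subst z|]; pos_lia.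
  by move=> /Tu[e|]; [subst y|]; pos_lia.
have neq e f : f \in nbrs G e -> e != x.
  by move=> ef; apply: (link_nbr_neq A (a := f)); rewrite nbrs_sym.
have cx : c != x by case: cb' => [->|/neq//]; apply: (tri_neq A).
have dx : d != x by case: da' => [->|/neq//]; apply: (tri_neq A).
have ingap := gap_nbr_bounds ab.
suff : l \in nbrs G c.
  by rewrite nbrs_sym => h; have e := one_nbr ntl h lu; subst u; pos_lia.
apply: (link_max A cx (neq _ _ lu)); first pos_lia; last first.
  apply: (gap_chord_planar A ab ingap lu) => // c' c'b h1 h2.
  have Qc' : Qc c' by rewrite /Qc c'b h2 orbT andbT; pos_lia.
  by have := cmax _ Qc'; pos_lia.
suff key T : T \in H -> ~ (blocks pos T c l \/ blocks pos T l c).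
  by move=> T TH; split=> B; apply: (key T TH); [left|right].
move=> TH B.
suff : u \in nbrs G d.
  by rewrite nbrs_sym => h; have e := one_nbr ntu h ul'; subst l; pos_lia.
apply: (link_max A' dx (neq _ _ ul')); first by rewrite fl; pos_lia.
  by move=> T' TH'; split=> B'; apply: (no_block T T'); auto.
apply: (gap_chord_planar A' ab' _ ul'); rewrite ?fl ?fle //.
- by move=> l1 u1; rewrite !fl !fle => h1 h2 /(ingap _ _ h2 h1)[].
- move=> l1 u1 h; rewrite !fl => *; apply: (outer u1 l1) => //.
  by rewrite nbrs_sym.
move=> c' c'a; rewrite !fl => h1 h2.
have Qd' : Qd c' by rewrite /Qd c'a h2 orbT andbT; pos_lia.
by have := dmin _ Qd'; pos_lia.
Qed.

Lemma gap_nbr a b l u : consecutive pos tri_set a b ->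
  pos a < pos l -> pos l < pos b -> u \in nbrs G l -> u = a \/ u = b.
Proof.
move=> ab al lb lu; have inj := pos_inj A.
have [au ub] := gap_nbr_bounds ab al lb lu.
case: (eqVneq u a) => [|/eqP ua]; first by left.
case: (eqVneq u b) => [|/eqP ub']; first by right.
have {}ua : pos u <> pos a by move=> /inj.
have {}ub' : pos u <> pos b by move=> /inj.
have ul : pos u <> pos l.
  by move=> /inj e; subst u; move: lu; rewrite inE eqxx.
have [ul'|lu'] : pos u < pos l \/ pos l < pos u by pos_lia.
  by case: (gap_no_edge ab _ ul' lb lu); pos_lia.
by case: (gap_no_edge ab al lu'); rewrite 1?nbrs_sym //; pos_lia.
Qed.

Lemma pred_in S lo c : lo \in S -> pos lo < pos c ->
  exists a, [/\ a \in S, pos a < pos c &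
              forall d, d \in S -> pos d < pos c -> pos d <= pos a].
Proof.
move=> loS loc; have Q : (lo \in S) && (pos lo < pos c) by rewrite loS.
case: (arg_maxnP (P := fun a => (a \in S) && (pos a < pos c)) pos Q) => a.
case/andP=> aS ac amax; exists a; split=> // d dS dc.
by apply: amax; rewrite dS.
Qed.

Lemma succ_in S hi c : hi \in S -> pos c < pos hi ->
  exists b, [/\ b \in S, pos c < pos b &
              forall d, d \in S -> pos c < pos d -> pos b <= pos d].
Proof.
move=> hiS chi; have Q : (hi \in S) && (pos c < pos hi) by rewrite hiS.
case: (arg_minnP (P := fun a => (a \in S) && (pos c < pos a)) pos Q) => b.
case/andP=> bS cb bmin; exists b; split=> // d dS dc.
by apply: bmin; rewrite dS.
Qed.

Lemma consecutive_around S lo hi c : lo \in S -> hi \in S -> c \notin S ->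
  pos lo <= pos c -> pos c <= pos hi ->
  exists a b, [/\ consecutive pos S a b, pos a < pos c & pos c < pos b].
Proof.
move=> loS hiS cS loc chi; have inj := pos_inj A.
have h1 : pos lo <> pos c by move=> /inj e; rewrite -e loS in cS.
have h2 : pos hi <> pos c by move=> /inj e; rewrite -e hiS in cS.
have [a [aS ac amax]] := pred_in loS (ltac:(pos_lia) : pos lo < pos c).
have [b [bS cb bmin]] := succ_in hiS (ltac:(pos_lia) : pos c < pos hi).
exists a, b; split=> //; split=> //; first by pos_lia.
move=> d dS [ad db].
have h3 : pos d <> pos c by move=> /inj e; rewrite -e dS in cS.
by have := amax d dS; have := bmin d dS; pos_lia.
Qed.

(** The graph induced on [S] contains every chord that it can contain without
    crossings; the polygon with corner set [S] is then triangulated. *)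
Definition planar_max S : Prop := forall a b, a \in S -> b \in S ->
  pos a < pos b ->
  (forall c d, c \in S -> d \in S -> d \in nbrs G c -> ~ separated pos a b c d) ->
  b \in nbrs G a.

(** By [tri_one_sided] no triangle avoiding [x] blocks a chord between triangulation
    points.  A chord of the graph that crosses it cannot end in a leaf, since leaves
    stay between two consecutive corners by [gap_nbr]. *)
Lemma tri_planar_max lo hi : lo \in tri_set -> hi \in tri_set ->
  (forall a, a != x -> pos lo <= pos a /\ pos a <= pos hi) ->
  planar_max tri_set.
Proof.
move=> loS hiS bd a b aS bS ab nosep.
have [ta tb] : tri_point G a /\ tri_point G b by move: aS bS; rewrite !inE.
apply: (link_max A (tri_neq A ta) (tri_neq A tb) ab).
  move=> T TH; split=> -[y [z []]]; rewrite !inE => /andP[_ yT] /andP[_ zT] eT.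
    exact: (tri_one_sided A ta TH eT yT zT).
  exact: (tri_one_sided A tb TH eT yT zT).
move=> c d cd [ac cb dout].
have dx := link_nbr_neq A cd.
have cx : c != x by apply: (link_nbr_neq A (a := d)); rewrite nbrs_sym.
case: (boolP (c \in tri_set)) => cS; last first.
  have [loc chi] := bd c cx.
  have [p [q [pq pc cq]]] := consecutive_around loS hiS cS loc chi.
  have := pq => -[pS qS _ gap].
  by have [e|e] := gap_nbr pq pc cq cd; subst d; move: (gap a aS) (gap b bS); pos_lia.
case: (boolP (d \in tri_set)) => dS.
  exact: (nosep c d cS dS cd).
have [lod dhi] := bd d dx.
have [p [q [pq pd dq]]] := consecutive_around loS hiS dS lod dhi.
have := pq => -[pS qS _ gap].
have dc : c \in nbrs G d by rewrite nbrs_sym.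
by have [e|e] := gap_nbr pq pd dq dc; subst c; move: (gap a aS) (gap b bS); pos_lia.
Qed.

End Structure.
End Link.

(** * Crossings in the linear order seen from a point *)

Section Position.

Variables (n : nat) (x : 'I_n).
Implicit Types (a b c d : 'I_n) (A B T : {set 'I_n}).

Definition position a : nat := if x <= a then a - x else a + n - x.

Lemma position_inj : injective position.
Proof.
move=> a b; rewrite /position => e; apply: ord_inj.
by move: (ltn_ord a) (ltn_ord b) (ltn_ord x) e; case: (leqP x a); case: (leqP x b); lia.
Qed.

Lemma position_lt a : position a < n.
Proof.
rewrite /position.
by move: (ltn_ord a) (ltn_ord x); case: (leqP x a); lia.
Qed.

Lemma position_base : position x = 0.
Proof. by rewrite /position leqnn subnn. Qed.

Lemma position_gt0 a : (0 < position a) = (a != x).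
Proof.
apply/idP/idP => [h|/eqP h].
  by apply/eqP => e; rewrite e position_base in h.
by rewrite lt0n; apply/eqP => e; apply: h; apply: position_inj; rewrite position_base.
Qed.

Lemma cyc_ordered3 a b c : cyc_ordered [:: a; b; c] =
  [|| (a < b) && (b < c), (b < c) && (c < a) | (c < a) && (a < b)].
Proof.
rewrite /cyc_ordered /=; apply/existsP/or3P => [[[[|[|[|//]]] i]]|].
- by rewrite /rot /= andbT; constructor 1.
- by rewrite /rot /= andbT; constructor 2.
- by rewrite /rot /= andbT; constructor 3.
case=> h.
- by exists (@Ordinal 3 0 isT); rewrite /rot /= andbT.
- by exists (@Ordinal 3 1 isT); rewrite /rot /= andbT.
- by exists (@Ordinal 3 2 isT); rewrite /rot /= andbT.
Qed.

Lemma cyc_ordered4 a b c d : cyc_ordered [:: a; b; c; d] =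
  [|| [&& a < b, b < c & c < d], [&& b < c, c < d & d < a],
      [&& c < d, d < a & a < b] | [&& d < a, a < b & b < c]].
Proof.
rewrite /cyc_ordered /=; apply/existsP/or4P => [[[[|[|[|[|//]]]] i]]|].
- by rewrite /rot /= andbT; constructor 1.
- by rewrite /rot /= andbT; constructor 2.
- by rewrite /rot /= andbT; constructor 3.
- by rewrite /rot /= andbT; constructor 4.
case=> h.
- by exists (@Ordinal 4 0 isT); rewrite /rot /= andbT.
- by exists (@Ordinal 4 1 isT); rewrite /rot /= andbT.
- by exists (@Ordinal 4 2 isT); rewrite /rot /= andbT.
- by exists (@Ordinal 4 3 isT); rewrite /rot /= andbT.
Qed.

Lemma cyc_ordered3_position a b c :
  [|| (a < b) && (b < c), (b < c) && (c < a) | (c < a) && (a < b)] =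
  [|| (position a < position b) && (position b < position c),
      (position b < position c) && (position c < position a)
    | (position c < position a) && (position a < position b)].
Proof.
rewrite /position.
move: (ltn_ord a) (ltn_ord b) (ltn_ord c) (ltn_ord x).
by case: (leqP x a); case: (leqP x b); case: (leqP x c); lia.
Qed.

Lemma cyc_ordered4_position a b c d : cyc_ordered [:: a; b; c; d] =
  let: (a, b, c, d) := (position a, position b, position c, position d) in
  [|| [&& a < b, b < c & c < d], [&& b < c, c < d & d < a],
      [&& c < d, d < a & a < b] | [&& d < a, a < b & b < c]].
Proof.
have split4 (i j k l : nat) :
    [|| [&& i < j, j < k & k < l], [&& j < k, k < l & l < i],
        [&& k < l, l < i & i < j] | [&& l < i, i < j & j < k]] =
    [|| (i < j) && (j < k), (j < k) && (k < i) | (k < i) && (i < j)] &&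
    [|| (i < k) && (k < l), (k < l) && (l < i) | (l < i) && (i < k)].
  case: (ltnP i j) => ij; case: (ltnP j k) => jk; case: (ltnP k l) => kl;
    case: (ltnP l i) => li; case: (ltnP k i) => ki; case: (ltnP i k) => ik //=; lia.
by rewrite cyc_ordered4 !split4 2!cyc_ordered3_position.
Qed.

Lemma cyc_ltE a b : cyc_lt x a b = (0 < position a) && (position a < position b).
Proof.
rewrite /cyc_lt cyc_ordered3 /position.
move: (ltn_ord a) (ltn_ord b) (ltn_ord x).
by case: (leqP x a); case: (leqP x b); lia.
Qed.

Lemma cyc_leE a b : a != x -> b != x ->
  cyc_le x a b = (position a <= position b).
Proof.
rewrite /cyc_le cyc_ltE -position_gt0 => -> _ /=.
by rewrite [RHS]leq_eqVlt; congr (_ || _); apply/esym/inj_eq/position_inj.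
Qed.

(** In the order seen from [x], a crossing starts with a point of one of the two
    triangles. *)
Definition alternating A B : Prop :=
  exists a b c d, [/\ a \in A :\: B /\ c \in A :\: B, b \in B :\: A /\ d \in B :\: A
   & [/\ position a < position b, position b < position c & position c < position d]].

Lemma crossingP A B : crossing A B <-> alternating A B \/ alternating B A.
Proof.
split.
  case/existsP=> a /andP[aA /existsP[c /andP[cA /existsP[b /andP[bB]]]]].
  case/existsP=> d /andP[dB]; rewrite cyc_ordered4_position => /or4P[]/and3P[h1 h2 h3].
  - by left; exists a, b, c, d.
  - by right; exists b, c, d, a.
  - by left; exists c, d, a, b.
  - by right; exists d, a, b, c.
case=> -[a [b [c [d [[h1 h2] [h3 h4] [h5 h6 h7]]]]]].
  apply/existsP; exists a; rewrite h1; apply/existsP; exists c; rewrite h2.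
  apply/existsP; exists b; rewrite h3; apply/existsP; exists d; rewrite h4.
  by rewrite cyc_ordered4_position h5 h6 h7.
apply/existsP; exists b; rewrite h3; apply/existsP; exists d; rewrite h4.
apply/existsP; exists c; rewrite h2; apply/existsP; exists a; rewrite h1.
by rewrite cyc_ordered4_position h5 h6 h7 !orbT.
Qed.

Lemma crossingC A B : crossing A B = crossing B A.
Proof. by apply/idP/idP => /crossingP h; apply/crossingP; case: h; auto. Qed.

(** A crossing of a triangle through [x] with one avoiding [x] can always be chosen
    to start with [x]: one of the two points of [{x, a, b}] that occur in it may be
    replaced by [x]. *)
Lemma crossing_far T a b : x \notin T ->
  crossing [set x; a; b] T <-> blocks position T a b \/ blocks position T b a.
Proof.
move=> xT; rewrite crossingP.
have side s y z : s \in [set x; a; b] -> s \notin T -> y \in T -> z \in T ->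
    y \notin [set x; a; b] -> z \notin [set x; a; b] ->
    position y < position s -> position s < position z ->
    blocks position T a b \/ blocks position T b a.
  rewrite !inE -!orbA => /or3P[]/eqP-> sT yT zT /norP[_ /norP[ya yb]] /norP[_ /norP[za zb]].
  - by rewrite position_base.
  - by left; exists y, z; split; rewrite // !inE ?yb ?zb.
  - by right; exists y, z; split; rewrite // !inE ?ya ?za.
split.
  case=> -[a0 [b0 [c0 [d0 [[/setDP[h1 h1'] /setDP[h2 h2']] [/setDP[h3 h3'] /setDP[h4 h4']] [h5 h6 h7]]]]]].
    exact: (side c0 b0 d0).
  exact: (side b0 a0 c0).
have blk a' b' : [set x; a; b] = [set x; a'; b'] -> blocks position T a' b' ->
    alternating [set x; a; b] T.
  move=> -> [y [z []]]; rewrite !inE => /andP[yb yT] /andP[zb zT] aT ya az.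
  exists x, y, a', z; split; rewrite ?inE ?eqxx ?orbT ?xT ?aT ?yT ?zT ?andbT //.
    have ny w : w \in T -> position w <> position a' -> w != b' ->
        ~~ [|| w == x, w == a' | w == b'].
      move=> wT wa wb; rewrite (negPf wb) orbF; apply/norP; split.
        by apply: contraNneq xT => <-.
      by apply/eqP => e; rewrite e in wa.
    by rewrite -!orbA; split; apply: ny => //; pos_lia.
  split=> //; rewrite position_base position_gt0.
  by apply: contraNneq xT => <-.
case=> B; first by left; apply: (blk a b).
by left; apply: (blk b a) => //; rewrite -!setUA [[set a] :|: _]setUC.
Qed.

Lemma crossing_near a b c d : a != x -> b != x -> c != x -> d != x ->
  position a < position b ->
  crossing [set x; a; b] [set x; c; d] <->
  separated position a b c d \/ separated position a b d c.
Proof.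
move=> ax bx cx dx ab; rewrite crossingP.
have elt A e f w : e != x -> f != x -> w \in [set x; e; f] :\: A -> x \in A ->
    w = e \/ w = f.
  move=> ex fx; rewrite !inE -orbA => /andP[wA /or3P[]/eqP e'] xA; subst w; auto.
  by rewrite xA in wA.
have x3 e f : x \in [set x; e; f] by rewrite !inE eqxx.
rewrite /separated; split.
  case=> -[a0 [b0 [c0 [d0 [[h1 h2] [h3 h4] [h5 h6 h7]]]]]].
    case: (elt _ _ _ _ ax bx h1 (x3 _ _)) => e1; case: (elt _ _ _ _ ax bx h2 (x3 _ _)) => e2;
    case: (elt _ _ _ _ cx dx h3 (x3 _ _)) => e3; case: (elt _ _ _ _ cx dx h4 (x3 _ _)) => e4;
    subst a0 b0 c0 d0; try (exfalso; pos_lia);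
    by [left; split=> //; apply/orP; right|right; split=> //; apply/orP; right].
  case: (elt _ _ _ _ cx dx h1 (x3 _ _)) => e1; case: (elt _ _ _ _ cx dx h2 (x3 _ _)) => e2;
  case: (elt _ _ _ _ ax bx h3 (x3 _ _)) => e3; case: (elt _ _ _ _ ax bx h4 (x3 _ _)) => e4;
  subst a0 b0 c0 d0; try (exfalso; pos_lia);
  by [left; split=> //; apply/orP; left|right; split=> //; apply/orP; left].
have mem A e f w : w \notin A -> w = e \/ w = f -> w \in [set x; e; f] :\: A.
  by move=> wA ef; rewrite inE wA !inE; case: ef => ->; rewrite eqxx ?orbT.
have out e f w : w != x -> position w <> position e -> position w <> position f ->
    w \notin [set x; e; f].
  by move=> wx we wf; rewrite !inE !negb_or wx /=; apply/andP; split; apply/eqP => E; subst w.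
have main c1 d1 : c1 != x -> d1 != x -> separated position a b c1 d1 ->
    alternating [set x; a; b] [set x; c1; d1] \/ alternating [set x; c1; d1] [set x; a; b].
  move=> {cx dx} cx dx [ac cb /orP[da|bd]].
    right; exists d1, a, c1, b; split; [split|split|split=> //].
    - by apply: mem; auto; apply: out => //; pos_lia.
    - by apply: mem; auto; apply: out => //; pos_lia.
    - by apply: mem; auto; apply: out => //; pos_lia.
    - by apply: mem; auto; apply: out => //; pos_lia.
  left; exists a, c1, b, d1; split; [split|split|split=> //].
  - by apply: mem; auto; apply: out => //; pos_lia.
  - by apply: mem; auto; apply: out => //; pos_lia.
  - by apply: mem; auto; apply: out => //; pos_lia.
  - by apply: mem; auto; apply: out => //; pos_lia.
case=> h; first exact: (main c d).
have -> : [set x; c; d] = [set x; d; c] by rewrite -!setUA [[set c] :|: _]setUC.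
exact: (main d c).
Qed.

End Position.

(** * Pairs and triples *)

Section SmallSets.
Variable T : finType.
Implicit Types a b c d p j : T.

Lemma set2_eq a b c d : [set a; b] = [set c; d] -> (a = c /\ b = d) \/ (a = d /\ b = c).
Proof.
move=> e; have: a \in [set c; d] by rewrite -e !inE eqxx.
have: b \in [set c; d] by rewrite -e !inE eqxx orbT.
have: c \in [set a; b] by rewrite e !inE eqxx.
have: d \in [set a; b] by rewrite e !inE eqxx orbT.
by rewrite !inE => /orP[]/eqP e1 /orP[]/eqP e2 /orP[]/eqP e3 /orP[]/eqP e4;
  subst; auto.
Qed.

Lemma set2_other a b j : j \in [set a; b] -> j != a -> j = b.
Proof. by rewrite in_set2 => /orP[/eqP->|/eqP//]; rewrite eqxx. Qed.

Lemma set3CA a b c : [set a; b; c] = [set b; a; c].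
Proof. by rewrite [[set a] :|: _]setUC. Qed.

Lemma set3AC a b c : [set a; b; c] = [set a; c; b].
Proof. by rewrite -!setUA [[set b] :|: _]setUC. Qed.

Lemma set3R p a b : [set p; a; b] = [set a; b; p].
Proof. by apply/setP => c; rewrite !inE -orbA orbC. Qed.

Lemma set3F p a b : [set p; a; b] = [set b; a; p].
Proof. by apply/setP => c; rewrite !inE; do 3! case: (c == _). Qed.

End SmallSets.

(** * The neighbours of the base point *)

Section PositionSteps.
Variables (n : nat) (x : 'I_n).
Implicit Types (a : 'I_n).

Lemma position_ordS a : (position x a).+1 < n ->
  position x (ordS a) = (position x a).+1.
Proof.
rewrite /position /=; move: (ltn_ord a) (ltn_ord x).
case: (eqVneq a.+1 n) => [e|ne] an xn.
  by rewrite e modnn; case: (leqP x a); case: (leqP x 0); lia.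
rewrite modn_small; last by lia.
by case: (leqP x a); case: (leqP x a.+1); lia.
Qed.

Lemma position_ord_pred a : a != x ->
  position x (ord_pred a) = (position x a).-1.
Proof.
rewrite -(inj_eq (@ord_inj n)) /position /=; move: (ltn_ord a) (ltn_ord x).
case: (eqVneq (nat_of_ord a) 0) => [e|ne] an xn.
  rewrite e add0n modn_small; last by lia.
  by case: (leqP x 0); case: (leqP x n.-1); lia.
have -> : (a + n).-1 = a.-1 + n by lia.
rewrite modnDr modn_small; last by lia.
by case: (leqP x a); case: (leqP x a.-1); lia.
Qed.

Lemma position_pred : position x (ord_pred x) = n.-1.
Proof.
rewrite /position /=; move: (ltn_ord x).
case: (eqVneq (nat_of_ord x) 0) => [e|ne] xn.
  by rewrite e add0n leq0n modn_small; lia.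
have -> : (x + n).-1 = x.-1 + n by lia.
rewrite modnDr modn_small; last by lia.
by case: (leqP x x.-1); lia.
Qed.

Hypothesis n5 : 5 <= n.
Local Notation "x+1" := (ordS x).
Local Notation "x-1" := (ord_pred x).
Local Notation "x+2" := (ordS (ordS x)).
Local Notation "x-2" := (ord_pred (ord_pred x)).

Lemma position_succ : position x x+1 = 1.
Proof. by rewrite position_ordS position_base; lia. Qed.

Lemma position_succ2 : position x x+2 = 2.
Proof. by rewrite position_ordS position_succ; lia. Qed.

Lemma position_pred2 : position x x-2 = n.-2.
Proof.
by rewrite position_ord_pred ?position_pred // -position_gt0 position_pred; lia.
Qed.

Lemma position_bounds a : a != x ->
  position x x+1 <= position x a /\ position x a <= position x x-1.
Proof.
by rewrite -position_gt0 position_succ position_pred; have := position_lt x a; lia.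
Qed.

End PositionSteps.

(** * The graph of a star satisfies the axioms of a link *)

Section Star.
Variables (n : nat) (x : 'I_n) (F : {set {set 'I_n}}).
Hypothesis Fmax : max_weakly_separated F.
Implicit Types (a b c d : 'I_n) (A B T : {set 'I_n}).

Local Notation G := (star_graph F x).
Local Notation H := [set T in F | x \notin T].
Local Notation "x+1" := (ordS x).
Local Notation "x-1" := (ord_pred x).
Local Notation "x+2" := (ordS (ordS x)).
Local Notation "x-2" := (ord_pred (ord_pred x)).

Lemma star_triangle A : A \in F -> #|A| = 3.
Proof.
move: Fmax => /maxsetp /andP[/forallP h _] AF.
by have := h A; rewrite AF => /eqP.
Qed.

Lemma star_noncrossing A B : A \in F -> B \in F -> ~~ crossing A B.
Proof.
move: Fmax => /maxsetp /andP[_ /forallP h] AF BF.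
by have := h A; rewrite AF => /forallP/(_ B); rewrite BF.
Qed.

Lemma star_max A : #|A| = 3 -> (forall B, B \in F -> ~~ crossing A B) -> A \in F.
Proof.
move=> A3 hA; suff <- : A |: F = F by rewrite !inE eqxx.
apply: (maxsetsup Fmax); last exact: subsetUr.
apply/andP; split; apply/forallP => B; apply/implyP; rewrite !inE.
  by case/predU1P=> [->|/star_triangle/eqP//]; apply/eqP.
move=> hB; apply/forallP=> C; apply/implyP; rewrite !inE => hC.
case/predU1P: hB => [->|BF]; case/predU1P: hC => [->|CF].
- by apply/negP => /existsP[a]; rewrite setDv inE.
- exact: hA.
- by rewrite (crossingC x) ?hA.
- exact: star_noncrossing.
Qed.

Lemma in_nbrs_star a b : (b \in nbrs G a) =
  [&& a != x, b != x, b != a & [set x; a; b] \in F].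
Proof.
rewrite inE andbC; case: (eqVneq b a) => [|ba]; rewrite ?andbF ?andbT //=.
apply/imsetP/and3P => [[C]|[ax bx CF]].
  rewrite inE => /andP[CF xC] e.
  have ax : a \in C :\ x by rewrite -e !inE eqxx.
  have bx : b \in C :\ x by rewrite -e !inE eqxx orbT.
  move: ax bx; rewrite !inE => /andP[ax _] /andP[bx _].
  by split=> //; rewrite -setUA e setD1K.
exists [set x; a; b]; first by rewrite !inE CF eqxx.
apply/setP => c; rewrite !inE.
case: (eqVneq c x) => //= ->; rewrite ![x == _]eq_sym.
by rewrite (negPf ax) (negPf bx).
Qed.

Lemma star_triangleP A : A \in F -> x \in A ->
  exists a b, [/\ b \in nbrs G a, a != b & A = [set x; a; b]].
Proof.
move=> AF xA; have := star_triangle AF; rewrite (cardsD1 x) xA add1n => -[].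
move/eqP/cards2P => [a [b [ab e]]]; exists a, b.
have eA : A = [set x; a; b] by rewrite -setUA -e setD1K.
rewrite in_nbrs_star -eA AF [b == a]eq_sym ab; split=> //=; rewrite andbT.
have: a \in A :\ x by rewrite e !inE eqxx.
have: b \in A :\ x by rewrite e !inE eqxx orbT.
by rewrite !inE => /andP[-> _] /andP[-> _].
Qed.

Lemma card_set3 a b c : a != b -> a != c -> b != c -> #|[set a; b; c]| = 3.
Proof.
move=> ab ac bc; rewrite -setUA cardsU1 cards2 !inE negb_or ab ac bc.
by [].
Qed.

Lemma link_axioms_star : link_axioms x G H n (position x).
Proof.
split.
- exact: position_inj.
- by move=> a; apply/ltnW/position_lt.
- by move=> a b; rewrite in_nbrs_star => /and4P[].
- by move=> T; rewrite inE => /andP[/star_triangle].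
- move=> T a b; rewrite in_nbrs_star inE => /and4P[_ _ _ abF] /andP[TF xT] B.
  by have := star_noncrossing abF TF; apply/negP; rewrite negbK; apply/crossing_far; auto.
- move=> a b c d; rewrite !in_nbrs_star => /and4P[ax bx _ abF] /and4P[cx dx _ cdF] S.
  have := star_noncrossing abF cdF; apply/negP; rewrite negbK.
  by apply/crossing_near => //; [case: S; lia|left].
- move=> T T' u l y z; rewrite !inE => /andP[TF xT] /andP[TF' xT'].
  move=> /andP[uT uT'] /andP[zT zT'] /andP[yT yT'] /andP[lT lT'] yu ul lz.
  have := star_noncrossing TF TF'; apply/negP; rewrite negbK.
  apply/(crossingP x); right; exists y, u, l, z.
  rewrite !inE uT uT' zT zT' yT yT' lT lT'; split; [by []|by []|by split].
move=> a b ax bx ab noT noE; rewrite in_nbrs_star ax bx /=.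
have ba : b != a by apply/eqP => e; subst b; lia.
rewrite ba /=; apply: star_max; first by apply: card_set3; rewrite eq_sym.
move=> B BF; apply/negP; case: (boolP (x \in B)) => xB.
  have [c [d [cd _ eB]]] := star_triangleP BF xB; rewrite eB.
  have dc : c \in nbrs G d by rewrite nbrs_sym.
  have := cd; rewrite in_nbrs_star => /and4P[cx dx _ _].
  by case/(crossing_near ax bx cx dx ab); [apply: noE|apply: noE].
have BH : B \in H by rewrite inE BF.
by have [h1 h2] := noT B BH; case/crossing_far.
Qed.

Hypothesis n5 : 5 <= n.

Let p1 := position_succ x n5.
Let p2 := position_succ2 x n5.
Let m1 := position_pred x.
Let m2 := position_pred2 x n5.

(** The three edges that bound the final graph come from triangles of consecutive
    points, which cross no triangle. *)
Lemma nbrs_succ : x+2 \in nbrs G x+1.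
Proof.
apply: (link_max link_axioms_star); rewrite -1?position_gt0 ?p1 ?p2 //.
  move=> T; rewrite inE => /andP[_ xT]; split=> -[y [z []]]; rewrite ?p1 ?p2 !inE.
    move=> /andP[_ yT] _ _ y1 _.
    have : y != x by apply: contraNneq xT => <-.
    by rewrite -position_gt0; lia.
  move=> /andP[y1 yT] _ _ y2 _.
  have yx : y != x by apply: contraNneq xT => <-.
  have : position x y = position x x+1 by move: yx; rewrite -position_gt0 p1; lia.
  by move/position_inj => e; rewrite e eqxx in y1.
by move=> c d _ []; rewrite p1 p2; lia.
Qed.

Lemma nbrs_ends : x-1 \in nbrs G x+1.
Proof.
apply: (link_max link_axioms_star); rewrite -1?position_gt0 ?p1 ?m1 //; try lia.
  move=> T; rewrite inE => /andP[_ xT]; split=> -[y [z []]]; rewrite ?p1 ?m1 !inE.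
    move=> /andP[_ yT] _ _ y1 _.
    have : y != x by apply: contraNneq xT => <-.
    by rewrite -position_gt0; lia.
  by move=> _ _ _ _; have := position_lt x z; lia.
move=> c d cd []; rewrite p1 m1 => _ _.
have := link_nbr_neq link_axioms_star cd; rewrite -position_gt0.
by have := position_lt x d; lia.
Qed.

Lemma nbrs_pred : x-2 \in nbrs G x-1.
Proof.
rewrite nbrs_sym.
apply: (link_max link_axioms_star); rewrite -1?position_gt0 ?m2 ?m1 //; try lia.
  move=> T; rewrite inE => /andP[_ xT]; split=> -[y [z []]]; rewrite ?m2 ?m1 !inE.
    move=> _ /andP[z1 zT] _ _ z2.
    have : position x z = position x x-1 by move: (position_lt x z) z2; rewrite m1; lia.
    by move/position_inj => e; rewrite e eqxx in z1.
  by move=> _ _ _ _; have := position_lt x z; lia.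
by move=> c d cd []; rewrite m2 m1; lia.
Qed.

Lemma tri_succ : tri_point G x+1.
Proof.
apply/tri_pointP; exists x+2, x-1; rewrite nbrs_succ nbrs_ends; split=> //.
by apply/eqP => e; have := p2; rewrite e m1; lia.
Qed.

Lemma tri_pred : tri_point G x-1.
Proof.
apply/tri_pointP; exists x-2, x+1; rewrite nbrs_pred nbrs_sym nbrs_ends; split=> //.
by apply/eqP => e; have := p1; rewrite -e m2; lia.
Qed.

End Star.

(** * The Pluecker relation *)

Section SmallDeterminants.
Import GRing.Theory.
Local Open Scope ring_scope.
Variable K : comNzRingType.

Lemma det2 (A : 'M[K]_2) : let m i j := A (inord i) (inord j) in
  \det A = m 0%N 0%N * m 1%N 1%N - m 0%N 1%N * m 1%N 0%N.
Proof.
move=> m; have mE i j : A i j = m i j by rewrite /m !inord_val.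
rewrite (expand_det_row _ ord0) !big_ord_recl big_ord0 /cofactor !det_mx11 !mxE !mE /=.
by rewrite /bump /= !addn0 expr0 expr1; ring.
Qed.

Lemma det3 (A : 'M[K]_3) : let m i j := A (inord i) (inord j) in
  \det A = m 0%N 0%N * (m 1%N 1%N * m 2%N 2%N - m 1%N 2%N * m 2%N 1%N)
  - m 0%N 1%N * (m 1%N 0%N * m 2%N 2%N - m 1%N 2%N * m 2%N 0%N)
  + m 0%N 2%N * (m 1%N 0%N * m 2%N 1%N - m 1%N 1%N * m 2%N 0%N).
Proof.
move=> m; have mE i j : A i j = m i j by rewrite /m !inord_val.
rewrite (expand_det_row _ ord0) !big_ord_recl big_ord0 /cofactor !det2 !mxE !mE /=.
rewrite /bump /= !inordK //=.
by rewrite expr0 expr1 expr2; ring.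
Qed.

End SmallDeterminants.

(** What the algorithm uses about the values: around a point [p], the value of the
    triangle [p, a, b] behaves like the oriented length of a segment [a, b]. *)
Definition fan_additive (C : nmodType) n (x : 'I_n) (G : {set {set 'I_n}})
    (val : {set 'I_n} -> C) : Prop :=
  forall p a b c, a \in nbrs G p -> b \in nbrs G p -> c \in nbrs G p ->
    position x a < position x b -> position x b < position x c ->
    (val [set p; a; b] + val [set p; b; c] = val [set p; a; c])%R.

Section Evaluation.
Import GRing.Theory.
Local Open Scope ring_scope.

Variables (R : realType) (n : nat) (x : 'I_n) (v : {rmorphism coord_ring R n -> R[i]}).
Implicit Types (a b c p : 'I_n) (M : 'M[R[i]]_(3, n)).

Lemma minorE M a b c : let m i j := M (inord i) j in
  minor M (a, b, c) =
    m 0%N a * (m 1%N b * m 2%N c - m 1%N c * m 2%N b)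
  - m 0%N b * (m 1%N a * m 2%N c - m 1%N c * m 2%N a)
  + m 0%N c * (m 1%N a * m 2%N b - m 1%N b * m 2%N a).
Proof.
move=> m; rewrite /minor det3 !mxE !(tnth_nth a) !inordK //.
Qed.

Lemma minor_rot M a b c : minor M (b, c, a) = minor M (a, b, c).
Proof. by rewrite !minorE; ring. Qed.

Lemma minor_swap M a b c : minor M (b, a, c) = - minor M (a, b, c).
Proof. by rewrite !minorE; ring. Qed.

(** The three-term relation for the columns [y], [a], [b], [c] modulo [p]. *)
Lemma minor_plucker M y p a b c :
  minor M (y, p, b) * minor M (p, a, c) =
  minor M (y, p, a) * minor M (p, b, c) + minor M (y, p, c) * minor M (p, a, b).
Proof. by rewrite !minorE; ring. Qed.

Lemma enum_set3 a b c : (a < b)%N -> (b < c)%N -> enum [set a; b; c] = [:: a; b; c].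
Proof.
move=> ab bc.
have tr : transitive (fun i j : 'I_n => (i < j)%N) by move=> j i k; apply: ltn_trans.
have ir : irreflexive (fun i j : 'I_n => (i < j)%N) by move=> i; apply: ltnn.
apply: (irr_sorted_eq tr ir).
- rewrite /enum_mem -enumT; apply: sorted_filter => //.
  by have := iota_ltn_sorted 0 n; rewrite -val_enum_ord sorted_map.
- by rewrite /= ab bc.
by move=> i; rewrite mem_enum !inE -orbA.
Qed.

(** A rotation of three columns does not change the determinant, so that triples in
    the order seen from [x] need no sign. *)
Lemma evaluation_minor : evaluation_hom v ->
  exists M, forall a b c, (position x a < position x b)%N ->
    (position x b < position x c)%N -> tri_val v [set a; b; c] = minor M (a, b, c).
Proof.
case=> M _ vM; exists M => a b c.
have val (i j k : 'I_n) : (i < j)%N -> (j < k)%N -> tri_val v [set i; j; k] = minor M (i, j, k).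
  by move=> ij jk; rewrite /tri_val enum_set3 // /Delta vM mevalXU /plucker_vec enum_rankK.
move=> ab bc.
have : [|| (a < b) && (b < c), (b < c) && (c < a) | (c < a) && (a < b)]%N.
  by rewrite (cyc_ordered3_position x) ab bc.
case/or3P=> /andP[h1 h2].
- exact: val.
- by rewrite set3CA set3AC val // minor_rot.
- by rewrite set3AC set3CA val // -minor_rot.
Qed.

Variable F : {set {set 'I_n}}.
Hypotheses (vhom : evaluation_hom v)
  (v1 : forall t, t \in star F x -> tri_val v t = 1).
Local Notation G := (star_graph F x).

(** For the signs [s q], equal to [minor M (x, p, q)], the value of [{p, q, r}] is
    [s q * s r * minor M (p, q, r)]; the relation between the minors, multiplied by
    the three signs, becomes the additivity. *)
Lemma tri_val_fan_additive : max_weakly_separated F -> fan_additive x G (tri_val v).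
Proof.
move=> Fmax p a b c pa pb pc ab bc; have [M vM] := evaluation_minor vhom.
have base q : q \in nbrs G p -> [/\ q != x, (0 < position x p)%N,
    (0 < position x q)%N & tri_val v [set x; p; q] = 1].
  rewrite in_nbrs_star // => /and4P[px qx _ pqF].
  by rewrite !position_gt0; split=> //; apply: v1; rewrite !inE pqF eqxx.
(* the sign that says on which side of [p] the point [q] lies, as seen from [x] *)
pose s q := minor M (x, p, q).
have up q : q \in nbrs G p -> (position x p < position x q)%N -> s q = 1.
  by case/base=> _ p0 _ <- pq; rewrite vM ?position_base.
have dn q : q \in nbrs G p -> (position x q < position x p)%N -> s q = -1.
  case/base=> _ _ q0 <- qp; rewrite set3AC vM ?position_base //.
  by rewrite /s -[LHS]minor_rot minor_swap minor_rot.
have ne q : q \in nbrs G p -> position x q != position x p.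
  by rewrite (inj_eq (@position_inj n x)) inE => /andP[].
have ss q : q \in nbrs G p -> s q * s q = 1.
  move=> pq; have := ne q pq; rewrite neq_ltn => /orP[h|h].
    by rewrite dn // mulrNN mulr1.
  by rewrite up // mulr1.
have sv q r : q \in nbrs G p -> r \in nbrs G p ->
    (position x q < position x r)%N ->
    tri_val v [set p; q; r] = s q * s r * minor M (p, q, r).
  move=> pq pr qr; have := ne q pq; have := ne r pr.
  rewrite !neq_ltn => /orP[rp|pr'] /orP[qp|pq'].
  - rewrite (dn q) // (dn r) // mulrNN !mul1r set3CA set3AC vM //.
    by rewrite -minor_rot -minor_rot.
  - by move: (ltn_trans (ltn_trans pq' qr) rp); rewrite ltnn.
  - by rewrite (dn q) // (up r) // mulr1 mulN1r set3CA vM // minor_swap.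
  - by rewrite (up q) // (up r) // !mul1r vM.
rewrite !sv //; last exact: ltn_trans bc.
have pl : s b * minor M (p, a, c) = s a * minor M (p, b, c) + s c * minor M (p, a, b).
  exact: minor_plucker.
move: (ss a pa) (ss b pb) (ss c pc) pl.
move: (s a) (s b) (s c) => sa sb sc.
move: (minor M (p, a, c)) (minor M (p, b, c)) (minor M (p, a, b)) => X Y Z.
move=> ea eb ec e.
transitivity (sa * sb * (sc * sc) * Z + sb * sc * (sa * sa) * Y).
  by rewrite ea ec !mulr1.
transitivity (sa * sb * sc * (sb * X)); first by rewrite e; ring.
transitivity (sa * sc * (sb * sb) * X); first by ring.
by rewrite eb mulr1.
Qed.

End Evaluation.

(** * The loop *)

Section Loop.

Variables (C : nmodType) (n : nat) (x : 'I_n) (F : {set {set 'I_n}}).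
Variable (val : {set 'I_n} -> C).
Hypotheses (Fmax : max_weakly_separated F) (n5 : 5 <= n).

Local Notation G := (star_graph F x).
Local Notation pos := (position x).
Local Notation "x+1" := (ordS x).
Local Notation "x-1" := (ord_pred x).
Local Notation "x+2" := (ordS (ordS x)).
Local Notation "x-2" := (ord_pred (ord_pred x)).

Hypothesis val_additive : fan_additive x G val.

Implicit Types (a b c d i j p q r : 'I_n) (V : {set 'I_n}) (l : {ffun 'I_n -> option C}).

Let A := link_axioms_star x Fmax.
Let p1 := position_succ x n5.
Let p2 := position_succ2 x n5.
Let m1 := position_pred x.
Let m2 := position_pred2 x n5.
Let inj := @position_inj n x.

Lemma star_edgeP e : e \in G -> exists a b, b \in nbrs G a /\ e = [set a; b].
Proof.
move=> eG; have := eG => /imsetP[T]; rewrite inE => /andP[TF xT] eT.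
have [a [b [ab _ TE]]] := star_triangleP Fmax TF xT.
exists a, b; split=> //; have := ab; rewrite in_nbrs_star // => /and4P[ax bx _ _].
rewrite eT TE; apply/setP => c; rewrite !inE.
by case: (eqVneq c x) => //= ->; rewrite ![x == _]eq_sym (negPf ax) (negPf bx).
Qed.

Definition end_edge (e : {set 'I_n}) : bool :=
  (e == [set x+1; x+2]) || (e == [set x-2; x-1]).

(** The graphs that occur in the loop: the part of [G] on the corner set [V] of the
    current polygon, and the edges from [x + 1] to [x + 2] and from [x - 1] to
    [x - 2], which stay as leaves once [x + 2] and [x - 2] are no longer corners. *)
Definition stage V : {set {set 'I_n}} :=
  [set e in G | (e \subset V) || end_edge e].

Lemma in_stage V e : (e \in stage V) = (e \in G) && ((e \subset V) || end_edge e).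
Proof. by rewrite inE. Qed.

(** At [x + 1] and [x - 1] nothing is claimed as long as [x + 2], respectively
    [x - 2], is a corner: the label there is overwritten when that corner is cut
    off. *)
Record loop_invariant V l : Prop := Invariant {
  inv_succ : x+1 \in V;
  inv_pred : x-1 \in V;
  inv_base : x \notin V;
  inv_max : planar_max G pos V;
  inv_label : forall a p b, consecutive pos V a p -> consecutive pos V p b ->
    l p = Some (val [set p; a; b]);
  inv_label_succ : forall b, x+2 \notin V -> consecutive pos V x+1 b ->
    l x+1 = Some (val [set x+1; x+2; b]);
  inv_label_pred : forall a, x-2 \notin V -> consecutive pos V a x-1 ->
    l x-1 = Some (val [set x-1; a; x-2])
}.

Lemma consecutive_nbrs V a b : planar_max G pos V -> consecutive pos V a b ->
  b \in nbrs G a.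
Proof.
move=> Vmax [aV bV ab gap]; apply: Vmax => // c d cV _ _ [ac cb _].
exact: (gap c).
Qed.

Lemma pos_gt0 V a : x \notin V -> a \in V -> 0 < pos a.
Proof. by move=> xV aV; rewrite position_gt0; apply: contraNneq xV => <-. Qed.

Lemma pos_between V a : x \notin V -> a \in V -> a != x+1 -> a != x-1 ->
  1 < pos a /\ pos a < n.-1.
Proof.
move=> xV aV; rewrite -!(inj_eq inj) p1 m1.
by move: (pos_gt0 xV aV) (position_lt x a); clear; lia.
Qed.

Lemma ends_neq : [/\ x+2 != x-2, x+2 != x+1, x+2 != x-1, x-2 != x+1 & x-2 != x-1].
Proof. by rewrite -!(inj_eq inj) p1 p2 m1 m2; clear -n5; split; lia. Qed.

Lemma nbrs_stage V i : x+1 \in V -> x-1 \in V -> i \in V -> i != x+1 -> i != x-1 ->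
  nbrs (stage V) i = nbrs G i :&: V.
Proof.
move=> sV pV iV i1 i2; apply/setP => b; rewrite !inE; case: (eqVneq b i) => //= bi.
case: (_ \in G) => //=; rewrite subUset !sub1set iV /=.
apply/idP/idP => [/orP[//|/orP[]/eqP/set2_eq[][h1 h2]]|->//].
- by rewrite h1 eqxx in i1.
- by rewrite h2.
- by rewrite h2.
- by rewrite h1 eqxx in i2.
Qed.

Lemma deg_stage_out V i : i \notin V -> i != x+1 -> i != x-1 -> deg (stage V) i <= 1.
Proof.
move=> iV i1 i2; have [ne _ _ _ _] := ends_neq.
rewrite /deg -(cards1 (if i == x+2 then x+1 else x-1)).
apply/subset_leq_card/subsetP => b; rewrite !inE => /and3P[bi _].
rewrite subUset sub1set (negPf iV) /=.
case/orP=> [/eqP/set2_eq[][h1 h2]|/eqP/set2_eq[][h1 h2]].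
- by rewrite h1 eqxx in i1.
- by rewrite h1 eqxx h2.
- by rewrite h1 [_ == x+2]eq_sym (negPf ne) h2.
- by rewrite h1 eqxx in i2.
Qed.

(** The predecessor and the successor are adjacent to [i], hence its only neighbours
    in [V]; no chord crosses the one between them, so it is in the graph. *)
Lemma ear_neighbours V i : x+1 \in V -> x-1 \in V -> x \notin V ->
  planar_max G pos V ->
  i \in V -> i != x+1 -> i != x-1 -> #|nbrs G i :&: V| = 2 ->
  exists a b, [/\ consecutive pos V a i, consecutive pos V i b,
                  nbrs G i :&: V = [set a; b], a != b & b \in nbrs G a].
Proof.
move=> sV pV xV Vmax iV i1 i2 c2.
have [li ri] := pos_between xV iV i1 i2.
have [a [aV ai amax]] := pred_in sV (ltac:(by rewrite p1) : pos x+1 < pos i).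
have [b [bV ib bmin]] := succ_in pV (ltac:(by rewrite m1) : pos i < pos x-1).
have cai : consecutive pos V a i.
  by split=> // c cV [h1 h2]; have := amax c cV h2; move: h1; clear; lia.
have cib : consecutive pos V i b.
  by split=> // c cV [h1 h2]; have := bmin c cV h1; move: h2; clear; lia.
have ab : a != b by rewrite -(inj_eq inj); move: ai ib; clear; lia.
have ear : nbrs G i :&: V = [set a; b].
  apply/esym/eqP; rewrite eqEcard c2 cards2 ab andbT subUset !sub1set !in_setI aV bV.
  by rewrite nbrs_sym (consecutive_nbrs Vmax cai) (consecutive_nbrs Vmax cib).
exists a, b; split=> //; apply: Vmax => //; first by move: ai ib; clear; lia.
move=> c d cV dV cd [ac cb dout].
have ci : c = i.
  apply: inj; move: (amax c cV) (bmin c cV) ac cb; clear; lia.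
subst c; have : d \in [set a; b] by rewrite -ear in_setI cd.
by rewrite !inE => /orP[]/eqP e; subst d; move: dout ai ib; clear; lia.
Qed.

(** Below a shortest chord that has corners under it there is just one corner: if
    [i] is the first of them, the chord from [i] to the far end can only be missing
    because of a shorter chord with a corner under it. *)
Lemma ear_exists V v : x+1 \in V -> x-1 \in V -> x \notin V ->
  planar_max G pos V -> v \in V -> v != x+1 -> v != x-1 ->
  exists i, [/\ i \in V, i != x+1, i != x-1 & #|nbrs G i :&: V| = 2].
Proof.
move=> sV pV xV Vmax vV v1 v2.
pose Q (e : 'I_n * 'I_n) := [&& e.1 \in V, e.2 \in V, e.2 \in nbrs G e.1,
  pos e.1 < pos e.2 & [exists w in V, (pos e.1 < pos w) && (pos w < pos e.2)]].
have Q0 : Q (x+1, x-1).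
  have [h1 h2] := pos_between xV vV v1 v2.
  rewrite /Q /= sV pV nbrs_ends // p1 m1 /=; apply/andP; split; first by clear -n5; lia.
  by apply/existsP; exists v; rewrite vV h1.
case: (arg_minnP (fun e : 'I_n * 'I_n => pos e.2 - pos e.1) Q0) => {Q0 vV v1 v2} -[a b].
case/and5P=> /= aV bV ab lab /existsP[w /and3P[wV aw wb]] emin.
have short a' b' w' : a' \in V -> b' \in V -> w' \in V -> b' \in nbrs G a' ->
    pos a' < pos w' -> pos w' < pos b' -> pos b - pos a <= pos b' - pos a'.
  move=> a'V b'V w'V a'b' h1 h2; apply: (emin (a', b')); rewrite /Q /= a'V b'V a'b'.
  rewrite (ltn_trans h1 h2) /=; apply/existsP; exists w'.
  by rewrite w'V h1.
have [i [iV ai imin]] := succ_in bV lab.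
have iw := imin w wV aw.
have cai : consecutive pos V a i.
  by split=> // c cV [h1 h2]; have := imin c cV h1; move: h2; clear; lia.
have noV c : c \in V -> ~ (pos i < pos c /\ pos c < pos b).
  move=> cV [ic cb].
  suff ib : b \in nbrs G i.
    by have := short i b c iV bV cV ib ic cb; move: ai ic cb; clear; lia.
  apply: Vmax => //; first by move: ic cb; clear; lia.
  move=> d e dV eV de [id db eout].
  have [eb|[ea|ea]] : pos b < pos e \/ pos e < pos a \/ pos e = pos a.
    have := imin e eV; move: eout; clear; lia.
  - by apply: (link_planar A ab de); split=> //; [move: ai id; clear; lia|rewrite eb orbT].
  - by apply: (link_planar A ab de); split=> //; [move: ai id; clear; lia|rewrite ea].
  have {}ea := inj ea; subst e; rewrite nbrs_sym in de.
  by have := short a d i aV dV iV de ai id; move: db ai id; clear; lia.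
have cib : consecutive pos V i b by split=> //; move: iw wb; clear; lia.
have ib : pos i < pos b by case: cib.
have ear : nbrs G i :&: V = [set a; b].
  apply/setP => c; rewrite in_setI in_set2; apply/andP/orP.
    case=> ic cV; have [|/orP h] := boolP ((pos c < pos a) || (pos b < pos c)).
      by move=> h; case: (link_planar A ab ic); split.
    have ci : pos c != pos i by rewrite (inj_eq inj); move: ic; rewrite inE => /andP[].
    have [h1|h1] : pos c = pos a \/ pos c = pos b.
      by move: (noV c cV) (imin c cV) h ci; clear; lia.
    + by left; apply/eqP/inj.
    + by right; apply/eqP/inj.
  have h1 := consecutive_nbrs Vmax cai; have h2 := consecutive_nbrs Vmax cib.
  by case=> /eqP->; rewrite // nbrs_sym.
have g0 := pos_gt0 xV aV; have gb := position_lt x b.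
exists i; split=> //.
- by rewrite -(inj_eq inj) p1; move: ai g0; clear; lia.
- by rewrite -(inj_eq inj) m1; move: ib gb; clear; lia.
by rewrite ear cards2 -(inj_eq inj); move: ai ib; clear; case: eqP; lia.
Qed.

Lemma consecutive_uniq_r V p q q' : consecutive pos V p q -> consecutive pos V p q' -> q = q'.
Proof.
case=> _ qV pq gap [_ q'V pq' gap']; apply: inj.
by move: (gap q' q'V) (gap' q qV) pq pq'; clear; lia.
Qed.

Lemma consecutive_uniq_l V p p' q : consecutive pos V p q -> consecutive pos V p' q -> p = p'.
Proof.
case=> pV _ pq gap [p'V _ pq' gap']; apply: inj.
by move: (gap p' p'V) (gap' p pV) pq pq'; clear; lia.
Qed.

(** The only new pair of consecutive corners is formed by the two neighbours of the
    removed one. *)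
Lemma consecutive_removed V a i b p q :
  consecutive pos V a i -> consecutive pos V i b ->
  consecutive pos (V :\ i) p q -> consecutive pos V p q \/ (p = a /\ q = b).
Proof.
case=> aV iV ai gap1 [_ bV ib gap2] [].
rewrite !in_setD1 => /andP[pi pV] /andP[qi qV] pq gap.
have gapS c : c \in V -> pos c != pos i -> ~ (pos p < pos c /\ pos c < pos q).
  by move=> cV ci; apply: gap; rewrite in_setD1 cV -(inj_eq inj) ci.
rewrite -(inj_eq inj) in pi; rewrite -(inj_eq inj) in qi.
case: (boolP ((pos p < pos i) && (pos i < pos q))) => [/andP[h1 h2]|h]; [right|left].
  split; apply: inj.
    by move: (gap1 p pV) (gapS a aV) h1 h2 ai; clear; lia.
  by move: (gap2 q qV) (gapS b bV) h1 h2 ib; clear; lia.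
split=> // c cV; case: (eqVneq (pos c) (pos i)) => [e|/(gapS c cV)//].
by rewrite e => -[h1 h2]; rewrite h1 h2 in h.
Qed.

Lemma planar_max_removed V a i b : planar_max G pos V ->
  consecutive pos V a i -> consecutive pos V i b ->
  nbrs G i :&: V = [set a; b] -> planar_max G pos (V :\ i).
Proof.
move=> Vmax [_ iV ai gap1] [_ _ ib gap2] ear c d; rewrite !in_setD1.
move=> /andP[ci cV] /andP[di dV] cd nosep; apply: Vmax => // e f eV fV ef S.
have ear' g : g \in V -> g \in nbrs G i -> g = a \/ g = b.
  move=> gV gi; have: g \in [set a; b] by rewrite -ear in_setI gi.
  by rewrite in_set2 => /orP[]/eqP; auto.
have inb : forall g, g \in nbrs G i -> g \in V -> pos g = pos a \/ pos g = pos b.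
  by move=> g gi gV; case: (ear' g gV gi) => ->; auto.
have [gc1 gc2] := (gap1 c cV, gap2 c cV); have [gd1 gd2] := (gap1 d dV, gap2 d dV).
rewrite -(inj_eq inj) in ci; rewrite -(inj_eq inj) in di.
case: S => h1 h2 h3.
case: (eqVneq e i) => [ei|ei].
  subst e; have := inb f ef fV; move: ai ib ci di gc1 gc2 gd1 gd2 cd h1 h2 h3; clear; lia.
case: (eqVneq f i) => [fi|fi].
  subst f; rewrite nbrs_sym in ef; have := inb e ef eV.
  move: ai ib ci di gc1 gc2 gd1 gd2 cd h1 h2 h3; clear; lia.
by apply: (nosep e f); rewrite ?in_setD1 ?ei ?fi.
Qed.

(** One statement for the three cases of the loop body, which only differ in that the
    label of [x + 1] or [x - 1] is replaced instead of increased when [i] is [x + 2]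
    or [x - 2].  All other labels are updated by additivity around [a] and [b]. *)
Lemma loop_invariant_removed V l l' a i b : loop_invariant V l ->
  consecutive pos V a i -> consecutive pos V i b ->
  nbrs G i :&: V = [set a; b] -> b \in nbrs G a ->
  (forall p, p != a -> p != b -> p != i -> l' p = l p) ->
  l' a = (if i == x+2 then l i else add_label (l a) (l i)) ->
  l' b = (if i == x-2 then l i else add_label (l b) (l i)) ->
  loop_invariant (V :\ i) l'.
Proof.
case=> sV pV xV Vmax lab labs labp cai cib ear gab l0 la lb.
have [aV iV ai _] := cai; have [_ bV ib _] := cib.
have [e1 e2 e3 e4 e5] := ends_neq.
have [posa posb] : 0 < pos a /\ pos b < n by rewrite (pos_gt0 xV aV) position_lt.
have i1 : i != x+1 by rewrite -(inj_eq inj) p1; move: ai posa; clear; lia.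
have i2 : i != x-1 by rewrite -(inj_eq inj) m1; move: ib posb; clear; lia.
have gai := consecutive_nbrs Vmax cai; have gib := consecutive_nbrs Vmax cib.
have gia : a \in nbrs G i by rewrite nbrs_sym.
have gbi : i \in nbrs G b by rewrite nbrs_sym.
have gba : a \in nbrs G b by rewrite nbrs_sym.
have li := lab _ _ _ cai cib.
have nab : a <> b by move=> e; subst b; move: ai ib; clear; lia.
have ia2 : i = x+2 -> a = x+1.
  by move=> e; apply: inj; move: ai posa; rewrite e p1 p2; clear; lia.
have ib2 : i = x-2 -> b = x-1.
  by move=> e; apply: inj; move: ib posb; rewrite e m1 m2; clear; lia.
have rem p q := @consecutive_removed V a i b p q cai cib.
have notr p q : consecutive pos (V :\ i) p q -> p != i /\ q != i.
  by case; rewrite !in_setD1 => /andP[-> _] /andP[-> _].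
split.
- by rewrite in_setD1 sV eq_sym i1.
- by rewrite in_setD1 pV eq_sym i2.
- by rewrite in_setD1 negb_and xV orbT.
- exact: planar_max_removed Vmax cai cib ear.
- move=> p q r pq qr; have [ni1 ni2] := notr _ _ pq; have [_ ni3] := notr _ _ qr.
  have [[e e']|pq'] : (p = a /\ q = b) \/ consecutive pos V p q by case: (rem _ _ pq); auto.
    subst p q; case: (rem _ _ qr) => [br|[e _]]; last by case: nab.
    have gbr := consecutive_nbrs Vmax br; have [_ rV br' _] := br.
    have nx : (i == x-2) = false.
      apply/eqP => /ib2 e; move: br'; rewrite e m1.
      by have := position_lt x r; clear; lia.
    rewrite lb nx li (lab _ _ _ cib br) /add_label /= GRing.addrC (set3F i a b).
    by rewrite val_additive // (ltn_trans ib).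
  case: (rem _ _ qr) => [qr'|[e e']]; last first.
    subst q r; have gpa := consecutive_nbrs Vmax pq'; have [pV' _ pa _] := pq'.
    have gap : p \in nbrs G a by rewrite nbrs_sym.
    have nx : (i == x+2) = false.
      apply/eqP => /ia2 e; move: pa; rewrite e p1.
      by have := pos_gt0 xV pV'; clear; lia.
    rewrite la nx li (lab _ _ _ pq' cai) /add_label /= (set3CA i a b).
    by rewrite val_additive // (ltn_trans pa).
  rewrite l0 //; first exact: lab.
    by apply/eqP => e; subst q; rewrite (consecutive_uniq_r qr' cai) eqxx in ni3.
  by apply/eqP => e; subst q; rewrite (consecutive_uniq_l pq' cib) eqxx in ni1.
- move=> r; rewrite in_setD1 negb_and negbK => s2 sr; have [_ ni] := notr _ _ sr.
  case: (rem _ _ sr) => [sr'|[e e']].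
    have na : x+1 != a.
      by apply/eqP => e; rewrite -e in cai; rewrite (consecutive_uniq_r sr' cai) eqxx in ni.
    have nb : x+1 != b.
      by rewrite -(inj_eq inj) p1; move: posa ai ib; clear; lia.
    rewrite l0 // 1?eq_sym //; apply: labs => //.
    case/orP: s2 => // /eqP e; case/eqP: na.
    by apply/esym/ia2.
  subst a r; case: (eqVneq i x+2) la => [e|ne] la.
    by rewrite la li e set3CA.
  rewrite eq_sym (negPf ne) /= in s2.
  rewrite la li (labs _ s2 cai) /add_label /= (set3CA i x+1 b) val_additive ?nbrs_succ //.
  by move: ne ai; rewrite -(inj_eq inj) p1 p2; clear; lia.
move=> r; rewrite in_setD1 negb_and negbK => s2 rs; have [ni _] := notr _ _ rs.
case: (rem _ _ rs) => [rs'|[e e']].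
  have nb : x-1 != b.
    by apply/eqP => e; rewrite -e in cib; rewrite (consecutive_uniq_l rs' cib) eqxx in ni.
  have na : x-1 != a.
    by rewrite -(inj_eq inj) m1; move: posb ai ib; clear; lia.
  rewrite l0 // 1?eq_sym //; apply: labp => //.
  case/orP: s2 => // /eqP e; case/eqP: nb.
  by apply/esym/ib2.
subst b r; case: (eqVneq i x-2) lb => [e|ne] lb.
  by rewrite lb li e set3F.
rewrite eq_sym (negPf ne) /= in s2.
rewrite lb li (labp _ s2 cib) /add_label /= GRing.addrC (set3F i a x-1) val_additive ?nbrs_pred //.
by move: ne ib; rewrite -(inj_eq inj) m1 m2; clear; lia.
Qed.

Lemma end_edge_succ e : end_edge e -> x+2 \in e -> e = [set x+2; x+1].
Proof.
have [h1 h2 h3 h4 h5] := ends_neq.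
case/orP=> /eqP->; rewrite in_set2; first by rewrite setUC.
by rewrite (negPf h1) (negPf h3).
Qed.

Lemma end_edge_pred e : end_edge e -> x-2 \in e -> e = [set x-2; x-1].
Proof.
have [h1 h2 h3 h4 h5] := ends_neq.
case/orP=> /eqP->; rewrite in_set2 //.
by rewrite (negPf h4) eq_sym (negPf h1).
Qed.

Lemma stage_remove V i : i != x+1 -> i != x-1 -> i != x+2 -> i != x-2 ->
  [set e in stage V | i \notin e] = stage (V :\ i).
Proof.
move=> i1 i2 i3 i4; apply/setP => e; rewrite inE !in_stage subsetD1.
case: (e \in G) => //=; case: (boolP (i \in e)) => ie; rewrite ?andbT // !andbF /=.
apply/esym/negP => /orP[]/eqP E; move: ie; rewrite E in_set2.
  by rewrite (negPf i1) (negPf i3).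
by rewrite (negPf i2) (negPf i4).
Qed.

(** Deleting one edge at [i] already removes the corner [i], as the other edge is the
    one that stays. *)
Lemma stage_cut V i p j : nbrs G i :&: V = [set p; j] -> p != j ->
  end_edge [set i; p] ->
  (forall e, end_edge e -> i \in e -> e = [set i; p]) ->
  stage V :\ [set i; j] = stage (V :\ i).
Proof.
move=> ear pj fip fi; apply/setP => e; rewrite in_setD1 !in_stage subsetD1.
have ip : [set i; p] != [set i; j].
  by apply/eqP => /set2_eq[][h1 h2]; move: pj; rewrite h2 ?h1 eqxx.
have inot : [set i; j] \subset V -> ~ end_edge [set i; j].
  by move=> _ /fi; rewrite in_set2 eqxx => /(_ isT) E; rewrite E eqxx in ip.
case: (boolP (e \in G)) => //=; last by rewrite andbF.
move=> eG; case: (boolP (end_edge e)) => fe.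
  rewrite !orbT andbT; apply/eqP => E.
  have ie : i \in e by rewrite E in_set2 eqxx.
  by rewrite -(fi e fe ie) E eqxx in ip.
rewrite !orbF; case: (boolP (e \subset V)) => //= eV; rewrite ?andbF ?andbT //.
case: (boolP (i \in e)) => ie; last first.
  by apply/eqP => E; rewrite E in_set2 eqxx in ie.
apply/negbTE; rewrite negbK.
have [c [d [cd E]]] := star_edgeP eG.
have ear' k : k \in nbrs G i -> k \in V -> [set i; k] = e -> e == [set i; j].
  move=> ki kV E'; have: k \in [set p; j] by rewrite -ear in_setI ki.
  rewrite in_set2 => /orP[]/eqP ek; subst k; last by rewrite -E'.
  by rewrite -E' fip in fe.
have [cV dV] : c \in V /\ d \in V.
  by move: eV; rewrite E subUset !sub1set => /andP[].
move: ie; rewrite E in_set2 => /orP[]/eqP ei; rewrite -E.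
  by apply: (ear' d); rewrite ?ei.
by apply: (ear' c); rewrite ?ei // 1?nbrs_sym // E setUC.
Qed.

Lemma stage_small V : (forall v, v \in V -> v = x+1 \/ v = x-1) -> #|stage V| <= 3.
Proof.
move=> hV.
apply: (@leq_trans #|[set [set x+1; x-1]; [set x+1; x+2]; [set x-2; x-1]]|); last first.
  by rewrite -setUA cardsU1 cards2; case: (_ \notin _); case: (_ != _).
apply/subset_leq_card/subsetP => e; rewrite in_stage => /andP[eG /orP[eV|]]; last first.
  by rewrite !inE -orbA /end_edge => ->; rewrite orbT.
have [c [d [cd E]]] := star_edgeP eG.
have dc : d != c by move: cd; rewrite inE => /andP[].
move: eV; rewrite E subUset !sub1set => /andP[/hV hc /hV hd].
rewrite !inE; case: hc hd dc => -> [] ->; rewrite ?eqxx //.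
by rewrite setUC eqxx.
Qed.

Lemma stage_large V v : x+1 \in V -> x-1 \in V -> x \notin V -> planar_max G pos V ->
  v \in V -> v != x+1 -> v != x-1 -> 3 < #|stage V|.
Proof.
move=> sV pV xV Vmax vV v1 v2; have [lv rv] := pos_between xV vV v1 v2.
have posE a b : a = b -> pos a = pos b by move=> ->.
have [f [fs fx vf]] : exists f, [/\ f \in stage V, ~~ end_edge f & v \in f].
  case: (eqVneq v x+2) => [e|v3].
    have [b [bV vb bmin]] := succ_in pV (ltac:(by rewrite m1) : pos v < pos x-1).
    have vb' : consecutive pos V v b.
      by split=> // c cV [h1 h2]; have := bmin c cV h1; move: h2; clear; lia.
    have gvb := consecutive_nbrs Vmax vb'.
    exists [set v; b]; split; last by rewrite in_set2 eqxx.
      rewrite in_stage subUset !sub1set vV bV andbT.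
      by move: gvb; rewrite inE => /andP[_ ->].
    have [h1 h2 h3 h4 h5] := ends_neq.
    apply/negP => /orP[]/eqP/set2_eq[][E1 E2].
    - by rewrite E1 eqxx in v1.
    - by rewrite E2 p1 in vb; move: vb lv; clear; lia.
    - by rewrite -E1 e eqxx in h1.
    - by rewrite E1 eqxx in v2.
  have [a [aV av amax]] := pred_in sV (ltac:(by rewrite p1) : pos x+1 < pos v).
  have av' : consecutive pos V a v.
    by split=> // c cV [h1 h2]; have := amax c cV h2; move: h1; clear; lia.
  have gav := consecutive_nbrs Vmax av'.
  exists [set a; v]; split; last by rewrite in_set2 eqxx orbT.
    rewrite in_stage subUset !sub1set vV aV andbT.
    by move: gav; rewrite inE => /andP[_ ->].
  apply/negP => /orP[]/eqP/set2_eq[][E1 E2].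
  - by rewrite E2 eqxx in v3.
  - by rewrite E2 eqxx in v1.
  - by rewrite E2 eqxx in v2.
  - by rewrite E1 E2 m1 m2 in av; move: av n5; clear; lia.
have fne e : end_edge e -> f != e by move=> fe; apply: contraNneq fx => ->.
apply/card_geqP; exists [:: f; [set x+1; x-1]; [set x+1; x+2]; [set x-2; x-1]].
split=> //.
  have n1 : f != [set x+1; x-1].
    by apply/eqP => E; move: vf; rewrite E in_set2 (negPf v1) (negPf v2).
  have n2 : f != [set x+1; x+2] by rewrite fne // /end_edge eqxx.
  have n3 : f != [set x-2; x-1] by rewrite fne // /end_edge eqxx orbT.
  have n4 : [set x+1; x-1] != [set x+1; x+2].
    by apply/eqP => /set2_eq[][/posE h1 /posE h2]; move: h1 h2 n5; rewrite p1 p2 m1; clear; lia.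
  have n6 : [set x+1; x-1] != [set x-2; x-1].
    by apply/eqP => /set2_eq[][/posE h1 /posE h2]; move: h1 h2 n5; rewrite p1 m2 m1; clear; lia.
  have n7 : [set x+1; x+2] != [set x-2; x-1].
    by apply/eqP => /set2_eq[][/posE h1 /posE h2]; move: h1 h2 n5; rewrite p1 p2 m2 m1; clear; lia.
  by rewrite /= !in_cons !in_nil !orbF !negb_or n1 n2 n3 n4 n6 n7.
have inG a b : b \in nbrs G a -> [set a; b] \in G by rewrite inE => /andP[].
move=> e; rewrite !in_cons in_nil orbF => /or4P[]/eqP->; rewrite ?in_stage.
- by move: fs; rewrite in_stage.
- by rewrite inG ?nbrs_ends //= subUset !sub1set sV pV.
- by rewrite inG ?nbrs_succ //= /end_edge eqxx orbT.
by rewrite inG 1?nbrs_sym ?nbrs_pred //= /end_edge eqxx !orbT.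
Qed.

Lemma selectableP V l i : loop_invariant V l -> selectable x (stage V) i ->
  exists a b, [/\ consecutive pos V a i, consecutive pos V i b,
    nbrs (stage V) i = [set a; b] /\ nbrs G i :&: V = [set a; b], a != b
    & b \in nbrs G a].
Proof.
case=> sV pV xV Vmax _ _ _ /and3P[i1 i2 /eqP d2].
have iV : i \in V.
  by apply/negPn/negP => iV; have := deg_stage_out iV i1 i2; rewrite d2.
have e := nbrs_stage sV pV iV i1 i2.
rewrite /deg e in d2; have [a [b [h1 h2 h3 h4 h5]]] := ear_neighbours sV pV xV Vmax iV i1 i2 d2.
by exists a, b; rewrite e.
Qed.

Lemma before_succ2 V a : x \notin V -> consecutive pos V a x+2 -> a = x+1.
Proof.
move=> xV [aV _ h _]; apply: inj; have := pos_gt0 xV aV.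
by move: h; rewrite p1 p2; clear; lia.
Qed.

Lemma after_pred2 V b : consecutive pos V x-2 b -> b = x-1.
Proof.
move=> [_ _ h _]; apply: inj; have := position_lt x b.
by move: h; rewrite m1 m2; clear; lia.
Qed.

Lemma loop_body_invariant V l st : loop_invariant V l -> loop_body x (stage V, l) st ->
  exists V' l', [/\ st = (stage V', l'), loop_invariant V' l' & #|V'| < #|V|].
Proof.
move=> I B; have xV := inv_base I; have [e1 e2 e3 e4 e5] := ends_neq.
have less i : i \in V -> #|V :\ i| < #|V| by move=> iV; rewrite (cardsD1 i V) iV.
inversion B as [E l0 j sel jn j1 [eE el] est|E l0 j sel _ jn j1 [eE el] est
               |E l0 i j k sel i1 i2 ijk jk [eE el] est]; subst E l0.
- have [a [b [ai ib [sn ear] ab gab]]] := selectableP I sel.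
  have ea := before_succ2 xV ai; subst a.
  rewrite sn in jn; have ej := set2_other jn j1; subst j.
  exists (V :\ x+2); eexists; split; last by apply: less; case: ai.
    rewrite (@stage_cut V x+2 x+1 b) //; last exact: end_edge_succ.
    by rewrite /end_edge setUC eqxx.
  apply: (loop_invariant_removed I ai ib ear gab).
  + by move=> p pa pb pi; rewrite ffunE (negPf pa) (negPf pb) (negPf pi).
  + by rewrite ffunE !eqxx.
  by rewrite ffunE eqxx [b == _]eq_sym (negPf ab) (negPf e1).
- have [a [b [ai ib [sn ear] ab gab]]] := selectableP I sel.
  have eb := after_pred2 ib; subst b.
  rewrite sn setUC in jn; have ej := set2_other jn j1; subst j.
  exists (V :\ x-2); eexists; split; last by apply: less; case: ai.
    rewrite (@stage_cut V x-2 x-1 a) //; last exact: end_edge_pred.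
    + by rewrite setUC.
    + by rewrite eq_sym.
    by rewrite /end_edge eqxx orbT.
  apply: (loop_invariant_removed I ai ib ear gab).
  + by move=> p pa pb pi; rewrite ffunE (negPf pa) (negPf pb) (negPf pi).
  + by rewrite ffunE eqxx (negPf ab) eq_sym (negPf e1).
  by rewrite ffunE !eqxx.
have [a [b [ai ib [sn ear] ab gab]]] := selectableP I sel.
have /and3P[i3 i4 _] := sel.
exists (V :\ i); eexists; split; last by apply: less; case: ai.
  by rewrite stage_remove.
rewrite sn in ijk; apply: (loop_invariant_removed I ai ib ear gab);
  case: (set2_eq ijk) => -[? ?]; subst j k.
- by move=> p pa pb pi; rewrite ffunE (negPf pa) (negPf pb) (negPf pi).
- by move=> p pa pb pi; rewrite ffunE (negPf pa) (negPf pb) (negPf pi).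
- by rewrite ffunE eqxx (negPf i1).
- by rewrite ffunE eqxx (negPf ab) (negPf i1).
- by rewrite ffunE eqxx eq_sym (negPf ab) (negPf i2).
by rewrite ffunE eqxx (negPf i2).
Qed.

Lemma loop_body_exists V l v : loop_invariant V l -> v \in V -> v != x+1 -> v != x-1 ->
  exists st, loop_body x (stage V, l) st.
Proof.
move=> I vV v1 v2; have [sV pV xV Vmax _ _ _] := I; have [e1 _ _ _ _] := ends_neq.
have [i [iV i1 i2 c2]] := ear_exists sV pV xV Vmax vV v1 v2.
have sel : selectable x (stage V) i.
  by rewrite /selectable i1 i2 /deg nbrs_stage // c2.
have [a [b [ai ib [sn ear] ab gab]]] := selectableP I sel.
case: (eqVneq i x+2) => [e|i3].
  subst i; have ea := before_succ2 xV ai; subst a.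
  by eexists; apply: (@LoopA C n x (stage V) l b); rewrite ?sn ?in_set2 ?eqxx ?orbT // eq_sym.
case: (eqVneq i x-2) => [e|i4].
  subst i; have eb := after_pred2 ib; subst b.
  by eexists; apply: (@LoopB C n x (stage V) l a); rewrite ?sn ?in_set2 ?eqxx.
by eexists; apply: (@LoopC C n x (stage V) l i a b).
Qed.

(** When all corners other than [x + 1] and [x - 1] are gone, these two are
    consecutive, and their labels are those of the invariant. *)
Lemma loop_correct V l : loop_invariant V l ->
  loop_ensures x (fun st => st.2 x+1 = Some (val [set x-1; x+1; x+2]) /\
                            st.2 x-1 = Some (val [set x-2; x-1; x+1])) (stage V, l).
Proof.
have [k] := ubnP #|V|; elim: k V l => // k IH V l Vk I.
have [sV pV xV Vmax _ labs labp] := I; have [e1 e2 e3 e4 e5] := ends_neq.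
case: (boolP [exists v in V, (v != x+1) && (v != x-1)]) => [/existsP[v]|].
  case/and3P=> vV v1 v2; apply: LoopIter.
  - exact: (stage_large sV pV xV Vmax vV v1 v2).
  - exact: (loop_body_exists I vV v1 v2).
  move=> st /(loop_body_invariant I)[V' [l' [-> I' V'V]]]; apply: IH => //.
  exact: leq_trans V'V _.
rewrite negb_exists => /forallP hV.
have {}hV v : v \in V -> v = x+1 \/ v = x-1.
  move=> vV; have := hV v; rewrite vV /= negb_and !negbK => /orP[]/eqP; auto.
have out v : v != x+1 -> v != x-1 -> v \notin V.
  by move=> v1 v2; apply/negP => /hV[e|e]; rewrite e eqxx in v1 v2.
have c : consecutive pos V x+1 x-1.
  split=> //; first by rewrite p1 m1; move: n5; clear; lia.
  by move=> v /hV[] -> []; rewrite p1 m1; clear; lia.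
apply: LoopExit; first by rewrite /running -leqNgt stage_small.
rewrite (labs _ (out _ e2 e3) c) (labp _ (out _ e4 e5) c); split; congr (Some (val _)).
  by rewrite set3R; apply/setP => q; rewrite !inE; do 3! case: (q == _).
by apply/setP => q; rewrite !inE; do 3! case: (q == _).
Qed.

End Loop.

(** * The initial state *)

Section Initialization.

Variables (C : nmodType) (n : nat) (x : 'I_n) (F : {set {set 'I_n}}).
Variables (val w : {set 'I_n} -> C).
Hypotheses (Fmax : max_weakly_separated F) (n5 : 5 <= n).

Local Notation G := (star_graph F x).
Local Notation pos := (position x).
Local Notation "x+1" := (ordS x).
Local Notation "x-1" := (ord_pred x).
Local Notation "x+2" := (ordS (ordS x)).
Local Notation "x-2" := (ord_pred (ord_pred x)).
Local Notation V0 := (tri_set G).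

Hypothesis val_additive : fan_additive x G val.
Hypothesis border_val : forall t, border_triangle G x t -> w t = val t.

Implicit Types (a b c d i j p q r u P Q : 'I_n).

Let A := link_axioms_star x Fmax.
Let p1 := position_succ x n5.
Let p2 := position_succ2 x n5.
Let m1 := position_pred x.
Let m2 := position_pred2 x n5.
Let inj := @position_inj n x.

Lemma succ_tri : x+1 \in V0.
Proof. by rewrite inE tri_succ. Qed.

Lemma pred_tri : x-1 \in V0.
Proof. by rewrite inE tri_pred. Qed.

Lemma base_not_tri : x \notin V0.
Proof. by rewrite inE; apply/negP => /(tri_neq A); rewrite eqxx. Qed.

Lemma star_planar_max : planar_max G pos V0.
Proof.
apply: (tri_planar_max A succ_tri pred_tri) => a ax.
exact: position_bounds.
Qed.

Lemma deg_leaf l u : u \in nbrs G l -> (deg G l == 1) = (l \notin V0).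
Proof.
move=> lu; rewrite inE /tri_point -ltnNge ltnS.
by rewrite eqn_leq andbC; have -> : 0 < deg G l by apply/card_gt0P; exists u.
Qed.

Lemma nontri_around l u : l \notin V0 -> u \in nbrs G l ->
  exists a b, [/\ consecutive pos V0 a b, pos a < pos l, pos l < pos b & u = a \/ u = b].
Proof.
move=> lV lu.
have lx : l != x by apply: (link_nbr_neq A (a := u)); rewrite nbrs_sym.
have [h1 h2] := position_bounds n5 lx.
have [a [b [ab al lb]]] := consecutive_around A succ_tri pred_tri lV h1 h2.
by exists a, b; split=> //; apply: (gap_nbr A ab al lb lu).
Qed.

Lemma leaf_around P Q : leaf_in G P Q -> Q \notin V0 /\
  ((exists2 b, consecutive pos V0 P b & pos P < pos Q /\ pos Q < pos b) \/
   (exists2 a, consecutive pos V0 a P & pos a < pos Q /\ pos Q < pos P)).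
Proof.
case/and3P=> dQ tP PQ; have QP : P \in nbrs G Q by rewrite nbrs_sym.
have QV : Q \notin V0 by rewrite -(deg_leaf QP).
split=> //; have [a [b [ab aQ Qb [e|e]]]] := nontri_around QV QP; subst P.
  by left; exists b.
by right; exists a.
Qed.

Lemma is_leafE Q P : P \in nbrs G Q -> tri_point G P -> is_leaf G Q = (Q \notin V0).
Proof.
move=> QP tP; rewrite -(deg_leaf QP); apply/existsP/idP => [[P' /and3P[]//]|dQ].
by exists P; rewrite /leaf_in dQ tP nbrs_sym.
Qed.

Lemma is_leaf_succ : is_leaf G x+2 = (x+2 \notin V0).
Proof.
by apply: (@is_leafE _ x+1); [rewrite nbrs_sym nbrs_succ|rewrite tri_succ].
Qed.

Lemma is_leaf_pred : is_leaf G x-2 = (x-2 \notin V0).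
Proof.
by apply: (@is_leafE _ x-1); [rewrite nbrs_sym nbrs_pred|rewrite tri_pred].
Qed.

Lemma removed_leaf_tri Q : Q \in V0 -> removed_leaf x G Q = false.
Proof.
rewrite inE /tri_point /removed_leaf => tQ; apply/negbTE/negP => /existsP[P /andP[/and3P[/eqP dQ _ _] _]].
by rewrite dQ in tQ.
Qed.

(** If [x + 2] is a corner, no leaf of [x + 1] has to be removed, for it would lie
    between the consecutive corners [x + 1] and [x + 2]; similarly at [x - 1]. *)
Lemma removed_leaf_nontri Q u : Q \notin V0 -> u \in nbrs G Q ->
  removed_leaf x G Q = ~~ end_edge x [set Q; u].
Proof.
move=> QV Qu; have [e1 e2 e3 e4 e5] := ends_neq x n5.
have [a [b [ab aQ Qb uab]]] := nontri_around QV Qu.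
have [aV bV _ gap] := ab.
have uV : u \in V0 by case: uab => ->.
have tu : tri_point G u by rewrite inE in uV.
have s1 : x+1 != x-1 by rewrite -(inj_eq inj) p1 m1; move: n5; clear; lia.
have Q1 : Q != x+1 by apply: contraNneq QV => ->; apply: succ_tri.
have Q2 : Q != x-1 by apply: contraNneq QV => ->; apply: pred_tri.
have -> : removed_leaf x G Q = [|| (u != x+1) && (u != x-1),
    [&& u == x+1, is_leaf G x+2 & Q != x+2] | [&& u == x-1, is_leaf G x-2 & Q != x-2]].
  rewrite /removed_leaf; apply/existsP/idP => [[P /andP[/and3P[_ _ QP]]]|h].
    suff -> : P = u by [].
    have ntQ : ~ tri_point G Q by move=> t; rewrite inE t in QV.
    by apply: (one_nbr ntQ _ Qu); rewrite nbrs_sym.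
  by exists u; rewrite h andbT /leaf_in (deg_leaf Qu) QV tu nbrs_sym.
have a0 := pos_gt0 base_not_tri aV; have bn := position_lt x b.
have fz : end_edge x [set Q; u] = (u == x+1) && (Q == x+2) || (u == x-1) && (Q == x-2).
  apply/idP/idP.
    case/orP=> /eqP/set2_eq[][h1 h2].
    - by rewrite h1 eqxx in Q1.
    - by rewrite h1 h2 !eqxx.
    - by rewrite h1 h2 !eqxx orbT.
    - by rewrite h1 eqxx in Q2.
  by case/orP=> /andP[/eqP-> /eqP->]; rewrite /end_edge ?[[set x+2; x+1]]setUC !eqxx ?orbT.
rewrite fz is_leaf_succ is_leaf_pred.
case: (eqVneq u x+1) => [eu|u1] /=.
  rewrite eu (negPf s1) /= !orbF; case: (eqVneq Q x+2) => //= [_|Q3]; first by rewrite andbF.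
  rewrite andbT; apply/negP => s2; apply: (gap x+2 s2).
  have ea : a = x+1.
    case: uab => e; first by rewrite -e.
    by move: a0 aQ Qb; rewrite -e eu p1; clear; lia.
  have h : pos Q != 2 by rewrite -p2 (inj_eq inj).
  by move: aQ Qb h; rewrite ea p1 p2; clear; lia.
case: (eqVneq u x-1) => [eu|u2] //=.
case: (eqVneq Q x-2) => //= [_|Q3]; first by rewrite andbF.
rewrite andbT; apply/negP => s2; apply: (gap x-2 s2).
have eb : b = x-1.
  case: uab => e; last by rewrite -e.
  by move: bn aQ Qb; rewrite -e eu m1; clear; lia.
have h : pos Q != n.-2 by rewrite -m2 (inj_eq inj).
by move: aQ Qb h; rewrite eb m1 m2; clear; lia.
Qed.

Lemma init_graphE : init_graph x G = stage x F V0.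
Proof.
apply/setP => e; rewrite in_stage inE; case: (boolP (e \in G)) => //= eG.
have [a [b [ab E]]] := star_edgeP Fmax eG.
have ba : a \in nbrs G b by rewrite nbrs_sym.
have -> : [forall Q in e, ~~ removed_leaf x G Q] =
    ~~ removed_leaf x G a && ~~ removed_leaf x G b.
  apply/forallP/andP => [h|[h1 h2] Q].
    by split; [have := h a|have := h b]; rewrite E !inE eqxx ?orbT.
  by rewrite E in_set2; apply/implyP => /orP[]/eqP->.
have two l u : l \notin V0 -> u \in nbrs G l -> u \in V0.
  move=> lV lu; have [c [d [[cV dV _ _] _ _ []->]]] := nontri_around lV lu; by [].
rewrite E subUset !sub1set; case: (boolP (a \in V0)) => aV; last first.
  have bV := two _ _ aV ab.
  by rewrite (removed_leaf_tri bV) (removed_leaf_nontri aV ab) negbK andbT.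
case: (boolP (b \in V0)) => bV; first by rewrite !removed_leaf_tri.
by rewrite (removed_leaf_tri aV) (removed_leaf_nontri bV ba) negbK setUC.
Qed.

Lemma fan_telescope p (s : seq 'I_n) lo hi : lo < hi ->
  (forall k, lo <= k <= hi -> nth p s k \in nbrs G p) ->
  (forall k, lo <= k < hi -> pos (nth p s k) < pos (nth p s k.+1)) ->
  (\sum_(lo <= k < hi) val [set p; nth p s k; nth p s k.+1] =
   val [set p; nth p s lo; nth p s hi])%R.
Proof.
elim: hi => // hi IH lohi nb lt; have [e|lh] : lo = hi \/ lo < hi by clear -lohi; lia.
  by rewrite e big_nat1.
rewrite big_nat_recr /=; last exact: ltnW.
rewrite IH //; first last.
- by move=> k /andP[k1 k2]; apply: lt; rewrite k1 ltnW.
- by move=> k /andP[k1 k2]; apply: nb; rewrite k1 leqW.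
have mono k : lo < k <= hi -> pos (nth p s lo) < pos (nth p s k).
  elim: k => // k IHk /andP[lk kh].
  have h : pos (nth p s k) < pos (nth p s k.+1) by apply: lt; rewrite -ltnS lk ltnW.
  have [e|lk'] : lo = k \/ lo < k by clear -lk; lia.
    by rewrite e.
  by apply: (ltn_trans _ h); apply: IHk; rewrite lk' ltnW.
apply: val_additive; rewrite ?mono ?lh ?leqnn //.
- by apply: nb; rewrite leqnn ltnW.
- by apply: nb; rewrite leqnSn ltnW.
- by apply: nb; rewrite leqnn ltnW.
by apply: lt; rewrite leqnn ltnW.
Qed.

Lemma fan_sum_val P lo hi : tri_point G P -> lo < hi -> hi <= fan_len G x P ->
  (P = x+1 -> 0 < lo) -> (P = x-1 -> hi <= (fan_len G x P).-1) ->
  (forall k, lo <= k <= hi -> nth P (fan G x P) k \in nbrs G P) ->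
  (forall k, lo <= k < hi ->
     pos (nth P (fan G x P) k) < pos (nth P (fan G x P) k.+1)) ->
  fan_sum x G w P lo hi = val [set P; nth P (fan G x P) lo; nth P (fan G x P) hi].
Proof.
move=> tP lohi hi_len Plo Phi nb lt; rewrite -fan_telescope // /fan_sum.
apply: eq_big_nat => k /andP[k1 k2]; apply: border_val; exists P, k; split=> //.
- exact: leq_trans hi_len.
- by case=> /Plo h e; rewrite e in k1; move: h k1; clear; lia.
by case=> /Phi h e; rewrite e in k2; move: h k2; clear; lia.
Qed.

(* the order in which corners and leaves are listed *)
Let before : rel 'I_n := relpre pos ltn.

Lemma before_trans : transitive before.
Proof. by move=> b a c; apply: ltn_trans. Qed.

Lemma sort_before (p : pred 'I_n) : (forall a, p a -> a != x) ->
  sorted before (sort (cyc_le x) (enum p)).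
Proof.
move=> px; set s := sort _ _.
have sx a : a \in s -> a != x by rewrite mem_sort mem_enum => /px.
have ss : sorted (cyc_le x) s.
  apply: (@sort_sorted_in _ [pred a | a != x]).
    by move=> a b ax bx; rewrite !cyc_leE // leq_total.
  by apply/allP => a; rewrite mem_enum => /px.
have us : uniq (map pos s) by rewrite (map_inj_uniq inj) sort_uniq enum_uniq.
have : sorted leq (map pos s).
  rewrite sorted_map; apply: sub_in_sorted ss; last exact: allss.
  by move=> a b /sx ax /sx bx; rewrite cyc_leE.
by rewrite /before -sorted_map ltn_sorted_uniq_leq us.
Qed.

Lemma next_consecutive a b : consecutive pos V0 a b -> next (tri_points G x) a = b.
Proof.
case=> aV bV ab gap; set s := tri_points G x.
have ss : sorted before s by apply: sort_before => c; apply: (tri_neq A).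
have mem c : (c \in s) = (c \in V0) by rewrite mem_sort mem_enum inE.
have [as_ bs] : a \in s /\ b \in s by rewrite !mem.
have lt_nth := sorted_ltn_nth before_trans a ss.
have ia : index a s < size s by rewrite index_mem.
have ib : index b s < size s by rewrite index_mem.
have iab : index b s = (index a s).+1.
  have [h|[h|h]] : index b s = (index a s).+1 \/ index b s <= index a s \/
      (index a s).+1 < index b s by lia.
  - by [].
  - case: (ltngtP (index b s) (index a s)) h => // [h _|e _].
      have := lt_nth (index b s) (index a s) ib ia h.
      by rewrite !nth_index // /before /= => h'; move: ab h'; clear; lia.
    by move: ab; rewrite -(nth_index a as_) -e nth_index // ltnn.
  have ic : (index a s).+1 < size s by apply: ltn_trans ib.
  have h1 := lt_nth (index a s) (index a s).+1 ia ic (ltnSn _).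
  have h2 := lt_nth (index a s).+1 (index b s) ic ib h.
  rewrite !nth_index // /before /= in h1 h2.
  by case: (gap (nth a s (index a s).+1)); rewrite -?mem ?mem_nth.
rewrite next_nth as_; move: iab bs; case: (s) => // y s' iys bys.
by have := nth_index y bys; rewrite iys.
Qed.

Lemma prev_consecutive a b : consecutive pos V0 a b -> prev (tri_points G x) b = a.
Proof.
move=> ab; rewrite -(next_consecutive ab) prev_next //.
by rewrite sort_uniq enum_uniq.
Qed.

Lemma mem_leaves P Q : (Q \in leaves G x P) = leaf_in G P Q.
Proof. by rewrite mem_sort mem_enum. Qed.

Lemma leaves_nbrs P Q : Q \in leaves G x P -> Q \in nbrs G P.
Proof. by rewrite mem_leaves => /and3P[]. Qed.

Lemma leaves_sorted P : sorted before (leaves G x P).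
Proof.
by apply: sort_before => Q /and3P[_ _ QP]; apply: (link_nbr_neq A QP).
Qed.

Lemma leaves_after a P Q : consecutive pos V0 a P -> Q \in leaves G x P -> before a Q.
Proof.
move=> aP; rewrite mem_leaves /before /= => /leaf_around[_ [[b _ [h _]]|[a' aP' [h _]]]].
  by case: aP => _ _ aP _; apply: ltn_trans h.
by rewrite (consecutive_uniq_l aP aP').
Qed.

Lemma leaves_before b P Q : consecutive pos V0 P b -> Q \in leaves G x P -> before Q b.
Proof.
move=> Pb; rewrite mem_leaves /before /= => /leaf_around[_ [[b' Pb' [_ h]]|[a _ [_ h]]]].
  by rewrite (consecutive_uniq_r Pb Pb').
by case: Pb => _ _ Pb _; apply: ltn_trans Pb.
Qed.

Lemma leaves_rcons_sorted b P : consecutive pos V0 P b ->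
  sorted before (rcons (leaves G x P) b).
Proof.
move=> Pb; have := leaves_sorted P; have : forall Q, Q \in leaves G x P -> before Q b.
  by move=> Q; apply: leaves_before.
case: (leaves G x P) => //= Q s lt ss; rewrite rcons_path ss /=.
by apply: lt; apply: mem_last.
Qed.

Lemma leaves_cons_path a P : consecutive pos V0 a P -> path before a (leaves G x P).
Proof.
move=> aP; rewrite path_min_sorted ?leaves_sorted //.
by apply/allP => Q; apply: leaves_after.
Qed.

Lemma init_label_mid a p b : consecutive pos V0 a p -> consecutive pos V0 p b ->
  init_label x G w p = Some (val [set p; a; b]).
Proof.
move=> ap pb; have [aV pV ap_lt _] := ap; have [_ bV pb_lt _] := pb.
have a0 := pos_gt0 base_not_tri aV; have bn := position_lt x b.
have np1 : p != x+1 by rewrite -(inj_eq inj) p1; move: ap_lt a0; clear; lia.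
have np2 : p != x-1 by rewrite -(inj_eq inj) m1; move: pb_lt bn; clear; lia.
have tp : tri_point G p by rewrite inE in pV.
have fanE : fan G x p = a :: rcons (leaves G x p) b.
  by rewrite /fan (next_consecutive pb) (prev_consecutive ap).
have fan_nbrs k : k < size (fan G x p) -> nth p (fan G x p) k \in nbrs G p.
  move=> /(mem_nth p); set Q := nth _ _ _; rewrite fanE inE mem_rcons inE.
  case/or3P=> [/eqP->|/eqP->|/leaves_nbrs//].
    by rewrite nbrs_sym (consecutive_nbrs star_planar_max ap).
  exact: (consecutive_nbrs star_planar_max pb).
have fan_size : size (fan G x p) = (fan_len G x p).+1 by rewrite fanE /= size_rcons.
have fan_path : path before a (rcons (leaves G x p) b).
  rewrite path_min_sorted ?leaves_rcons_sorted //.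
  apply/allP => Q; rewrite mem_rcons inE => /predU1P[->|/(leaves_after ap)//].
  exact: ltn_trans pb_lt.
rewrite ffunE (negPf np1) (negPf np2) tp; congr Some.
rewrite fan_sum_val //.
- by rewrite fanE /= nth_rcons ltnn eqxx.
- by move=> e; rewrite e eqxx in np1.
- by move=> e; rewrite e eqxx in np2.
- by move=> k /andP[_ hk]; apply: fan_nbrs; rewrite fan_size.
move=> k /andP[_ hk]; rewrite fanE; apply: (pathP p fan_path).
by rewrite size_rcons.
Qed.

(** The first leaf of [x + 1] is [x + 2], so the sum starting with the fan triangle of
    index 1 telescopes from [x + 2] to the next corner. *)
Lemma init_label_succ b : x+2 \notin V0 -> consecutive pos V0 x+1 b ->
  init_label x G w x+1 = Some (val [set x+1; x+2; b]).
Proof.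
move=> leaf2 sb; have [_ bV sb_lt _] := sb.
set L := leaves G x x+1; have Ls : sorted before L by apply: leaves_sorted.
have L2 : x+2 \in L.
  have h := nbrs_succ x Fmax n5; have h' := h; rewrite nbrs_sym in h'.
  by rewrite mem_leaves /leaf_in (deg_leaf h') leaf2 tri_succ.
have L0 : 0 < size L by case: (L) L2.
have L_above Q : Q \in L -> 1 < pos Q.
  rewrite mem_leaves => /leaf_around[_ [[b' _ [h _]]|[a [aV _ h _] _]]].
    by rewrite p1 in h.
  by have := pos_gt0 base_not_tri aV; rewrite p1 in h; move: h; clear; lia.
have head2 : nth x+1 L 0 = x+2.
  case: (posnP (index x+2 L)) => [e|i0]; first by rewrite -e nth_index.
  have ii : index x+2 L < size L by rewrite index_mem.
  have := sorted_ltn_nth before_trans x+1 Ls _ _ L0 ii i0.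
  rewrite nth_index // /before /= p2 => h.
  by have := leq_trans h (L_above _ (mem_nth x+1 L0)); rewrite ltnn.
rewrite ffunE eqxx is_leaf_succ leaf2; congr Some.
have fanS k : nth x+1 (fan G x x+1) k.+1 = nth x+1 (rcons L b) k.
  by rewrite /fan (next_consecutive sb).
have len : fan_len G x x+1 = (size L).+1 by [].
rewrite fan_sum_val ?tri_succ ?len //.
- by rewrite !fanS !nth_rcons L0 head2 ltnn eqxx.
- move/(congr1 pos); rewrite p1 m1; move: n5; clear; lia.
- case=> // k hk; rewrite fanS.
  have: nth x+1 (rcons L b) k \in rcons L b by rewrite mem_nth ?size_rcons.
  rewrite mem_rcons inE => /predU1P[->|/leaves_nbrs//].
  exact: (consecutive_nbrs star_planar_max sb).
case=> // k hk; rewrite !fanS; apply: (sortedP x+1 (leaves_rcons_sorted sb)).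
by rewrite size_rcons.
Qed.

(** The last leaf of [x - 1] is [x - 2], at index [r_s - 1] of the fan; omitting the
    last fan triangle makes the sum end there. *)
Lemma init_label_pred a : x-2 \notin V0 -> consecutive pos V0 a x-1 ->
  init_label x G w x-1 = Some (val [set x-1; a; x-2]).
Proof.
move=> leaf2 ap; have [aV _ ap_lt _] := ap.
set L := leaves G x x-1; have Ls : sorted before L by apply: leaves_sorted.
have L2 : x-2 \in L.
  have h := nbrs_pred x Fmax n5; have h' := h; rewrite nbrs_sym in h'.
  by rewrite mem_leaves /leaf_in (deg_leaf h') leaf2 tri_pred.
have L0 : 0 < size L by case: (L) L2.
have L_below Q : Q \in L -> pos Q <= n.-2.
  rewrite mem_leaves => /leaf_around[_ [[b [_ _ h _] _]|[a' _ [_ h]]]].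
    by have := position_lt x b; rewrite m1 in h; move: h; clear; lia.
  by rewrite m1 in h; move: h; clear; lia.
have LL : (size L).-1 < size L by rewrite prednK.
have last2 : nth x-1 L (size L).-1 = x-2.
  have ii : index x-2 L < size L by rewrite index_mem.
  case: (ltngtP (index x-2 L) (size L).-1) => [i0|i0|<-]; last by rewrite nth_index.
    have := sorted_ltn_nth before_trans x-1 Ls _ _ ii LL i0.
    rewrite nth_index // /before /= m2 => h.
    by have := leq_trans h (L_below _ (mem_nth x-1 LL)); rewrite ltnn.
  by exfalso; move: i0 ii; clear; lia.
have s1 : x-1 != x+1 by rewrite -(inj_eq inj) p1 m1; move: n5; clear; lia.
rewrite ffunE (negPf s1) eqxx is_leaf_pred leaf2; congr Some.
have len : fan_len G x x-1 = (size L).+1 by [].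
have fanE k : k <= size L -> nth x-1 (fan G x x-1) k = nth x-1 (a :: L) k.
  move=> hk; rewrite /fan (prev_consecutive ap) -rcons_cons nth_rcons /=.
  by rewrite ltnS hk.
rewrite fan_sum_val ?tri_pred ?len //.
- rewrite !fanE //=; congr (val [set _; _; _]).
  by rewrite -last2 -[in LHS](prednK L0).
- by move=> e; rewrite e eqxx in s1.
- move=> k /andP[_ hk]; rewrite fanE //.
  have: nth x-1 (a :: L) k \in a :: L by rewrite mem_nth.
  rewrite inE => /predU1P[->|/leaves_nbrs//].
  by rewrite nbrs_sym (consecutive_nbrs star_planar_max ap).
move=> k /andP[_ hk]; rewrite !fanE //; last exact: ltnW.
exact: (pathP x-1 (leaves_cons_path ap)).
Qed.

Lemma init_invariant : loop_invariant x F val V0 (init_label x G w).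
Proof.
split.
- exact: succ_tri.
- exact: pred_tri.
- exact: base_not_tri.
- exact: star_planar_max.
- exact: init_label_mid.
- exact: init_label_succ.
exact: init_label_pred.
Qed.

End Initialization.

Theorem mainTheorem5 (R : realType) (n : nat) (x : 'I_n)
    (F : {set {set 'I_n}}) (v : {rmorphism coord_ring R n -> R[i]})
    (w : {set 'I_n} -> R[i]) :
  (5 <= n)%N ->
  max_weakly_separated F ->
  evaluation_hom v ->
  (forall t, t \in star F x -> tri_val v t = 1%R) ->
  (forall t, border_triangle (star_graph F x) x t -> w t = tri_val v t) ->
  algorithm_computes x (star_graph F x) w
    (tri_val v [set ord_pred x; ordS x; ordS (ordS x)])
    (tri_val v [set ord_pred (ord_pred x); ord_pred x; ordS x]).
Proof.
move=> n5 Fmax vhom v1 border.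
have add := tri_val_fan_additive vhom v1 Fmax.
rewrite /algorithm_computes /init_state init_graphE //.
apply: (@loop_correct _ _ _ _ (tri_val v)) => //.
exact: init_invariant.
Qed.
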